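(* Let $A$ be an arbitrary (bounded or unbounded) normal, in particular self-adjoint, operator in a nonzero complex Hilbert space $(X,(\cdot,\cdot),\|\cdot\|)$ with spectral measure $E_A(\cdot)$. Then $A$ is not hypercyclic, and neither is the collection $\{e^{tA}\}_{t\ge 0}$ of its exponentials (which, provided the spectrum of $A$ is located in a left half-plane $\{\lambda\in\mathbb{C} \mid \operatorname{Re}\lambda\le\omega\}$ with some $\omega\in\mathbb{R}$, is the $C_0$-semigroup generated by $A$).
   Context: Hypercyclicity of an operator: for a (bounded or unbounded) linear operator $A$ with domain $D(A)$ in a (real or complex) Banach space $X$, let $C^\infty(A):=\bigcap_{n=0}^\infty D(A^n)$, where $A^0:=I$ is the identity operator on $X$. A nonzero vector $f\in C^\infty(A)$ is called hypercyclic for $A$ if its orbit $\{A^nf\}_{n\in\mathbb{Z}_+}$, $\mathbb{Z}_+:=\{0,1,2,\dots\}$, is dense in $X$. The operator $A$ is called hypercyclic if it possesses a hypercyclic vector. Hypercyclicity of a collection: a collection $\{T(t)\}_{t\in J}$ ($J$ a nonempty indexing set) of linear operators in $X$ is called hypercyclic if there is a vector $f\in\bigcap_{t\in J}D(T(t))$ whose orbit $\{T(t)f\}_{t\in J}$ is dense in $X$. Operational calculus: for a normal operator $A$ in a complex Hilbert space $X$, $E_A(\cdot)$ denotes its strongly $\sigma$-additive spectral measure (resolution of the identity), assigning to Borel sets of $\mathbb{C}$ orthogonal projections on $X$ and having the spectrum $\sigma(A)$ as its support. For a Borel measurable $F:\sigma(A)\to\mathbb{C}$, the normal operator $F(A):=\int_{\sigma(A)}F(\lambda)\,dE_A(\lambda)$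 has domain $D(F(A))=\{f\in X \mid \int_{\sigma(A)}|F(\lambda)|^2\,d(E_A(\lambda)f,f)<\infty\}$. In particular, $A^n=\int_{\sigma(A)}\lambda^n\,dE_A(\lambda)$ for $n\in\mathbb{Z}_+$, and the exponentials are defined by $e^{tA}:=\int_{\sigma(A)}e^{t\lambda}\,dE_A(\lambda)$, $t\in\mathbb{R}$ (possibly unbounded operators). *)

(* Defs.v *)
From HB Require Import structures.
From mathcomp Require Import all_boot all_order all_algebra.
From mathcomp Require Import all_classical all_reals all_analysis.
From mathcomp Require Import complex.

Set Implicit Arguments.
Unset Strict Implicit.
Unset Printing Implicit Defensive.

Import Order.TTheory GRing.Theory Num.Theory.
Import numFieldNormedType.Exports.

Local Open Scope classical_set_scope.
Local Open Scope complex_scope.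
Local Open Scope ring_scope.

(* A possibly unbounded operator: only the values of [app] on [dom] matter.
   Linearity is the separate predicate [is_linear_op]. *)
Record operator (X : Type) := Operator { dom : set X ; app :> X -> X }.

Definition op_eq (X : Type) (A B : operator X) : Prop :=
  dom A = dom B /\ forall f, dom A f -> A f = B f.

Definition op_id (X : Type) : operator X := Operator setT id.

Definition op_comp (X : Type) (A B : operator X) : operator X :=
  Operator [set f | dom B f /\ dom A (B f)] (A \o B).

Fixpoint op_pow (X : Type) (A : operator X) (n : nat) : operator X :=
  if n is m.+1 then op_comp A (op_pow A m) else op_id X.

Definition Cinfty (X : Type) (A : operator X) : set X :=
  \bigcap_n dom (op_pow A n).

Section Operators.
Variables (K : numFieldType) (X : normedModType K).
Implicit Types A : operator X.

Definition is_linear_op A : Prop :=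
  dom A 0 /\
  forall (a : K) (f g : X), dom A f -> dom A g ->
    dom A (a *: f + g) /\ A (a *: f + g) = a *: A f + A g.

Definition closed_op A : Prop :=
  closed [set p : X * X | dom A p.1 /\ p.2 = A p.1].

Definition hypercyclic_vector A (f : X) : Prop :=
  [/\ f != 0, Cinfty A f & dense [set op_pow A n f | n in [set: nat]]].

Definition hypercyclic A : Prop := exists f, hypercyclic_vector A f.

Definition hypercyclic_collection (I : Type) (J : set I) (T : I -> operator X)
    : Prop :=
  exists f, (\bigcap_(t in J) dom (T t)) f /\ dense [set T t f | t in J].

Definition resolvent_set A : set K :=
  [set z | exists B : X -> X,
    [/\ linear B, continuous B,
        forall g, dom A (B g) /\ A (B g) - z *: B g = g
      & forall f, dom A f -> B (A f - z *: f) = f]].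

Definition spectrum A : set K := ~` resolvent_set A.

End Operators.

(* Complex Hilbert spaces: the inner product, linear in its first argument,
   induces the complete norm. *)
HB.mixin Record CompleteNormedModule_isHilbert (R : realType) X
    & CompleteNormedModule R[i] X := {
  inner : {dot X for Num.conj} ;
  inner_norm : forall f : X, inner f f = `|f| ^+ 2
}.

#[short(type="hilbertType")]
HB.structure Definition Hilbert (R : realType) :=
  {X of CompleteNormedModule R[i] X & CompleteNormedModule_isHilbert R X}.

Section Hilbert.
Variables (R : realType) (X : hilbertType R).
Implicit Types A : operator X.

(* [get] picks the value of the adjoint, unique when [dom A] is dense. *)
Definition adjoint A : operator X :=
  Operator
    [set g | exists h, forall f, dom A f -> inner (A f) g = inner f h]
    (fun g => get [set h | forall f, dom A f -> inner (A f) g = inner f h]).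

Definition normal_op A : Prop :=
  [/\ is_linear_op A, dense (dom A), closed_op A
    & op_eq (op_comp (adjoint A) A) (op_comp A (adjoint A))].

Definition orthogonal_projection (P : X -> X) : Prop :=
  [/\ linear P, forall f, P (P f) = P f
    & forall f g, inner (P f) g = inner f (P g)].

End Hilbert.

Notation borelC R := (g_sigma_algebraType (@open (complex R)^o)).

(* The values of [proj] on non-Borel sets are irrelevant. *)
Record spectral_measure (R : realType) (X : hilbertType R) := SpectralMeasure {
  proj :> set (borelC R) -> X -> X ;
  proj_orthogonal : forall B, measurable B -> orthogonal_projection (proj B) ;
  proj_set0 : forall f, proj set0 f = 0 ;
  proj_setT : forall f, proj setT f = f ;
  proj_setI : forall B D, measurable B -> measurable D ->
    forall f, proj (B `&` D) f = proj B (proj D f) ;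
  proj_sigma_additive : forall F : (set (borelC R))^nat,
    (forall i, measurable (F i)) -> trivIset setT F -> forall f,
    (fun n => \sum_(0 <= i < n) proj (F i) f) @ \oo --> proj (\bigcup_i F i) f
}.

Section SpectralMass.
Variables (R : realType) (X : hilbertType R) (E : spectral_measure X) (f : X).

(* The measure B |-> (E(B)f, f). The modulus changes nothing on Borel sets,
   where (E(B)f, f) = |E(B)f|^2, and makes the function nonnegative on the
   other ones. *)
Definition spectral_mass (B : set (borelC R)) : \bar R :=
  (Normc.normc (inner (E B f) f))%:E.

Let innerE B : measurable B -> inner (E B f) f = inner (E B f) (E B f).
Proof. by move=> /(proj_orthogonal E)[_ PP Psa]; rewrite -Psa PP. Qed.

Let mass_complex B : measurable B ->
  (Normc.normc (inner (E B f) f))%:C = inner (E B f) f.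
Proof.
move=> mB; have : 0 <= inner (E B f) f by rewrite innerE// dnorm_ge0.
by move=> /ger0_norm.
Qed.

Let sum_mass (F : (set (borelC R))^nat) n :
  (forall i, measurable (F i)) -> trivIset setT F ->
  (\sum_(0 <= i < n) Normc.normc (inner (E (F i) f) f))%:C =
  `|\sum_(0 <= i < n) E (F i) f| ^+ 2.
Proof.
move=> mF tF; rewrite -inner_norm.
elim: n => [|n IHn]; first by rewrite !big_nil linear0l.
have [_ _ En] := proj_orthogonal E (mF n).
have ortho : inner (\sum_(0 <= i < n) E (F i) f) (E (F n) f) = 0.
  rewrite linear_sumlz/= big_nat big1// => i /andP[_ ltin].
  rewrite -En -proj_setI//; have /trivIsetP/(_ n i I I) := tF.
  by rewrite gt_eqF// => ->//; rewrite proj_set0 linear0l.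
rewrite !big_nat_recr//= rmorphD/= mass_complex// IHn innerE//.
by rewrite (hnormDd ortho).
Qed.

Let spectral_mass0 : spectral_mass set0 = 0%E.
Proof. by rewrite /spectral_mass proj_set0 linear0l Normc.normc0. Qed.

Let spectral_mass_ge0 B : (0 <= spectral_mass B)%E.
Proof. by rewrite lee_fin; case: (inner _ _) => a b; exact: sqrtr_ge0. Qed.

Let spectral_mass_sigma_additive : semi_sigma_additive spectral_mass.
Proof.
move=> F mF tF mU; rewrite /spectral_mass.
under eq_fun do rewrite sumEFin.
apply: cvg_EFin; first exact: nearW.
have cvS := @proj_sigma_additive _ _ E F mF tF f.
have cvN : (fun n => `|\sum_(0 <= i < n) E (F i) f| ^+ 2 : (R[i])^o) @ \oo -->
    (`|E (\bigcup_i F i) f| ^+ 2 : (R[i])^o).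
  by apply: cvgM; apply: cvg_norm.
apply/cvgrPdist_lt => e e0.
move/cvgrPdist_lt : cvN => /(_ e%:C); rewrite ltcR => /(_ e0).
apply: filterS => n /= H; set r := (X in X - _); set r_ := (X in _ - X).
suff : `|(r - r_)%:C| < e%:C.
  by rewrite normc_def/= expr0n/= addr0 sqrtr_sqr ltcR.
by rewrite rmorphB/= /r /r_ mass_complex// sum_mass// innerE// inner_norm.
Qed.

HB.instance Definition _ := isMeasure.Build _ _ _ spectral_mass
  spectral_mass0 spectral_mass_ge0 spectral_mass_sigma_additive.

End SpectralMass.

(* Borel simple functions \sum_k c_k 1_(B_k), the B_k not necessarily disjoint. *)
Record simple_fct (R : realType) := SimpleFct {
  sf_size : nat ;
  sf_coef : 'I_sf_size -> R[i] ;
  sf_set : 'I_sf_size -> set (borelC R) ;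
  sf_measurable : forall k, measurable (sf_set k)
}.

Definition sf_eval (R : realType) (s : simple_fct R) (z : borelC R) : R[i] :=
  \sum_(k < sf_size s) sf_coef k * \1_(sf_set k) z.

Section SpectralIntegral.
Variables (R : realType) (X : hilbertType R) (E : spectral_measure X).
Variable D : set (borelC R).

Definition sf_spectral_integral (s : simple_fct R) (f : X) : X :=
  \sum_(k < sf_size s) sf_coef k *: E (sf_set k `&` D) f.

Definition sqL2 (f : X) (F : borelC R -> R[i]) : \bar R :=
  (\int[spectral_mass E f]_(z in D) ((Normc.normc (F z)) ^+ 2)%:E)%E.

(* y is the L^2-limit of the integrals at f of simple functions converging to
   F in L^2(D, (E(.)f, f)). *)
Definition spectral_integral_at (F : borelC R -> R[i]) (f y : X) : Prop :=
  exists s : (simple_fct R)^nat,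
    (sqL2 f (F \- sf_eval (s n)) @[n --> \oo] --> 0%E) /\
    (sf_spectral_integral (s n) f @[n --> \oo] --> y).

(* The operator \int_D F dE. *)
Definition spectral_integral (F : borelC R -> R[i]) : operator X :=
  Operator [set f | (sqL2 f F < +oo)%E]
    (fun f => get [set y | spectral_integral_at F f y]).

Definition spectral_support : set R[i] :=
  [set z | forall U : set (R[i])^o, open U -> U z -> exists f, E U f != 0].

End SpectralIntegral.

Section OperationalCalculus.
Variables (R : realType) (X : hilbertType R).
Variables (A : operator X) (E : spectral_measure X).

Definition fct_of_op (F : R[i] -> R[i]) : operator X :=
  spectral_integral E (spectrum A) F.

Definition is_spectral_measure_of : Prop :=
  spectral_support E = spectrum A /\ op_eq A (fct_of_op id).

Definition cexp (z : R[i]) : R[i] :=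
  (expR (complex.Re z))%:C * (cos (complex.Im z) +i* sin (complex.Im z)).

Definition exp_op (t : R) : operator X := fct_of_op (fun z => cexp (t%:C * z)).

End OperationalCalculus.

Section Semigroup.
Variables (R : realType) (X : completeNormedModType R[i]).
Variable T : R -> operator X.

Definition C0_semigroup : Prop :=
  [/\ forall t, 0 <= t -> [/\ dom (T t) = setT, linear (T t) & continuous (T t)],
      forall f, T 0 f = f,
      forall s t f, 0 <= s -> 0 <= t -> T (s + t) f = T s (T t f)
    & forall f, T t f @[t --> 0^'+] --> f].

Definition generator : operator X :=
  Operator
    [set f | cvg ((t^-1)%:C *: (T t f - f) @[t --> 0^'+])]
    (fun f => lim ((t^-1)%:C *: (T t f - f) @[t --> 0^'+])).

End Semigroup.

(* Main.v *)
(** A normal operator satisfies [|A u| = |A^* u|] for [u] in the domain of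
    [A^* A = A A^*].  Minimising [|v - g|^2 + e |A v|^2] over [v] in the domain
    of [A] solves [e A^* A u + u = g]; as [e] tends to 0 the solutions [u]
    tend to [g] with [|A^* u| = |A u| <= |A g|], and taking [g = A f] gives
    [|A f|^2 <= |f| |A^2 f|], with no appeal to the spectral theorem.  The
    norms of an orbit thus form a log-convex sequence, which is either bounded
    or bounded away from 0, so the orbit is not dense.

    For the exponentials, [|e^(tA) f|^2] is the integral of [e^(2 t Re z)]
    against the measure [(E(.) f, f)].  If this measure charges [Re z > 0],
    the orbit stays away from 0, otherwise it is bounded.

    When [Re z <= w] on the spectrum, multiplicativity of the integral of
    bounded functions yields the semigroup law; [((e^(tA) f - f) / t)]
    converges to [A f] for [f] in the domain of [A] by dominated convergence,
    and conversely Fatou's lemma puts in the domain of [A] any [f] for which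
    this quotient converges. *)

From HB Require Import structures.
Require Import Defs.
From mathcomp Require Import all_boot all_order all_algebra.
From mathcomp Require Import all_classical all_reals all_analysis.
From mathcomp Require Import measurable_realfun complex.
From mathcomp Require Import ring lra.

Import Order.TTheory GRing.Theory Num.Theory.
Import numFieldNormedType.Exports.

Local Open Scope classical_set_scope.
Local Open Scope ring_scope.

Set Implicit Arguments.
Unset Strict Implicit.
Unset Printing Implicit Defensive.

(** * Geometry of the Hilbert space *)

Section ComplexParts.
Variable R : realType.
Implicit Types z : R[i].

Lemma Re_add z w : complex.Re (z + w) = complex.Re z + complex.Re w.
Proof. by case: z w => [a b] []. Qed.

Lemma Im_add z w : complex.Im (z + w) = complex.Im z + complex.Im w.
Proof. by case: z w => [a b] []. Qed.

Lemma Re_opp z : complex.Re (- z) = - complex.Re z.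
Proof. by case: z. Qed.

Lemma Im_opp z : complex.Im (- z) = - complex.Im z.
Proof. by case: z. Qed.

Lemma Re_mul z w : complex.Re (z * w) =
  complex.Re z * complex.Re w - complex.Im z * complex.Im w.
Proof. by case: z w => [a b] []. Qed.

Lemma Im_mul z w : complex.Im (z * w) =
  complex.Re z * complex.Im w + complex.Im z * complex.Re w.
Proof. by case: z w => [a b] []. Qed.

Lemma Re_conj z : complex.Re (Num.conj z) = complex.Re z.
Proof. by case: z. Qed.

Lemma normc_sqr z :
  (Normc.normc z) ^+ 2 = complex.Re z ^+ 2 + complex.Im z ^+ 2.
Proof. by case: z => a b /=; rewrite sqr_sqrtr// addr_ge0// sqr_ge0. Qed.

Lemma normc_normr z : (real_complex R) (Normc.normc z) = `|z|.
Proof. by rewrite normc_def; case: z. Qed.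

(** In the order of [R[i]] only real numbers are positive, so the complex radii of balls reduce to
    real ones. *)
Lemma complex_gt0P z : 0 < z -> exists2 e : R, 0 < e & z = e%:C%C.
Proof.
case: z => a b; rewrite ltcE/= => /andP[/eqP -> a0]; by exists a.
Qed.

End ComplexParts.

Section SquaredNorm.
Variables (R : realType) (X : hilbertType R).
Implicit Types f g h : X.

(** The real part turns [X] into a real inner product space, so that estimates take place in the
    ordered field [R] rather than in [R[i]]. *)
Definition rdot f g : R := complex.Re (inner f g).
Definition sqnorm f : R := rdot f f.

Lemma sqnormE f : (sqnorm f)%:C%C = `|f| ^+ 2.
Proof.
rewrite -inner_norm /sqnorm /rdot.
by apply: RRe_real; rewrite ger0_real// dnorm_ge0.
Qed.

Lemma sqnorm_ge0 f : 0 <= sqnorm f.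
Proof. by rewrite -lecR sqnormE exprn_ge0. Qed.

Lemma innerC f g : inner f g = Num.conj (inner g f).
Proof. by rewrite (hermC (@inner R X)) expr0 mul1r. Qed.

Lemma innerZr_real (a : R) f g : inner f (a%:C%C *: g) = a%:C%C * inner f g.
Proof.
rewrite innerC linearZl_LR/= rmorphM/= -innerC; congr (_ * _).
exact: conjc_real.
Qed.

Lemma innerNr f g : inner f (- g) = - inner f g.
Proof. exact: linearNr. Qed.

Lemma rdotC f g : rdot f g = rdot g f.
Proof. by rewrite /rdot innerC Re_conj. Qed.

Lemma rdotDl f g h : rdot (f + g) h = rdot f h + rdot g h.
Proof. by rewrite /rdot linearDl Re_add. Qed.

Lemma rdotNl f h : rdot (- f) h = - rdot f h.
Proof. by rewrite /rdot linearNl Re_opp. Qed.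

Lemma rdotZl (a : R) f h : rdot (a%:C%C *: f) h = a * rdot f h.
Proof. by rewrite /rdot linearZl_LR/= Re_mul/= mul0r subr0. Qed.

Lemma rdotDr f g h : rdot f (g + h) = rdot f g + rdot f h.
Proof. by rewrite rdotC rdotDl ![rdot _ f]rdotC. Qed.

Lemma rdotNr f h : rdot f (- h) = - rdot f h.
Proof. by rewrite rdotC rdotNl rdotC. Qed.

Lemma rdotZr (a : R) f h : rdot f (a%:C%C *: h) = a * rdot f h.
Proof. by rewrite rdotC rdotZl rdotC. Qed.

Lemma rdot_suml (I : Type) (l : seq I) (x : I -> X) g :
  rdot (\sum_(i <- l) x i) g = \sum_(i <- l) rdot (x i) g.
Proof.
elim: l => [|i l IHl]; first by rewrite !big_nil /rdot linear0l.
by rewrite !big_cons rdotDl IHl.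
Qed.

Lemma sqnorm0 : sqnorm 0 = 0.
Proof. by rewrite /sqnorm /rdot linear0l. Qed.

Lemma sqnorm_eq0 f : sqnorm f = 0 -> f = 0.
Proof.
move=> f0; apply/eqP; by rewrite -normr_eq0 -sqrf_eq0 -sqnormE f0.
Qed.

Lemma sqnormD f g : sqnorm (f + g) = sqnorm f + sqnorm g + 2 * rdot f g.
Proof. rewrite /sqnorm rdotDl !rdotDr [rdot g f]rdotC; lra. Qed.

Lemma sqnormN f : sqnorm (- f) = sqnorm f.
Proof. by rewrite /sqnorm rdotNl rdotNr opprK. Qed.

Lemma sqnormB f g : sqnorm (f - g) = sqnorm f + sqnorm g - 2 * rdot f g.
Proof. by rewrite sqnormD sqnormN rdotNr mulrN. Qed.

Lemma sqnormBC f g : sqnorm (f - g) = sqnorm (g - f).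
Proof. by rewrite -sqnormN opprB. Qed.

Lemma sqnormZ (a : R[i]) f : sqnorm (a *: f) = Normc.normc a ^+ 2 * sqnorm f.
Proof.
apply: complexI; rewrite sqnormE normrZ exprMn -sqnormE rmorphM/=.
by rewrite rmorphXn/= normc_normr.
Qed.

Lemma sqnormD_le f g : sqnorm (f + g) <= 2 * sqnorm f + 2 * sqnorm g.
Proof. by have := sqnorm_ge0 (f - g); rewrite sqnormB sqnormD; lra. Qed.

Lemma sqnormB_triangle f g h :
  sqnorm (f - h) <= 2 * sqnorm (f - g) + 2 * sqnorm (g - h).
Proof.
by rewrite (_ : f - h = f - g + (g - h)) ?sqnormD_le// addrA subrK.
Qed.

Lemma sqnorm_eq0_eq f g : sqnorm (f - g) = 0 -> f = g.
Proof. by move/sqnorm_eq0/eqP; rewrite subr_eq0 => /eqP. Qed.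

(** If [g] is nonzero, the squared norm of [f] minus its real projection on [g] is nonnegative and
    equals the gap between the two sides divided by [sqnorm g]. *)
Lemma rdot_CauchySchwarz f g : rdot f g ^+ 2 <= sqnorm f * sqnorm g.
Proof.
have [g0|/eqP g0] := eqVneq (sqnorm g) 0.
  rewrite g0 mulr0 (sqnorm_eq0 g0) -(scaler0 _ (0%:C%C)) rdotZr mul0r.
  by rewrite expr0n.
have gp : 0 < sqnorm g by rewrite lt_def sqnorm_ge0 andbT; apply/eqP.
have := sqnorm_ge0 (f - (rdot f g / sqnorm g)%:C%C *: g).
rewrite sqnormB rdotZr sqnormZ normc_sqr/= expr0n/= addr0.
set x := rdot f g; set a := sqnorm f; set b := sqnorm g in g0 gp *.
have -> : a + (x / b) ^+ 2 * b - 2 * (x / b * x) = (a * b - x ^+ 2) / b.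
  by field; apply/eqP.
by rewrite pmulr_lge0 ?invr_gt0// subr_ge0.
Qed.

Lemma sqnorm_lt f (e : R) : 0 < e -> (sqnorm f < e ^+ 2) = (`|f| < e%:C%C).
Proof.
move=> e0; have e0' : (0 : R[i]) <= e%:C%C by rewrite lecR ltW.
by rewrite -[RHS](ltr_pXn2r (n:=2)) ?nnegrE// -sqnormE -rmorphXn/= ltcR.
Qed.

(** The norm of [X] takes values in [R[i]]. This lemma and its converse below let every limit in [X]
    be computed with real squared distances. *)
Lemma cvg_sqnorm (T : Type) (F : set_system T) {FF : Filter F} (u : T -> X)
  (y : X) : sqnorm (u t - y) @[t --> F] --> (0 : R) -> u @ F --> y.
Proof.
move=> /cvgrPdist_lt H; apply/cvgrPdist_lt => _ /complex_gt0P[e e0 ->].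
have e2 : 0 < e ^+ 2 by rewrite exprn_gt0.
apply: filterS (H _ e2) => t.
by rewrite sub0r normrN ger0_norm ?sqnorm_ge0// sqnorm_lt// distrC.
Qed.

Lemma sqnorm_cvg (T : Type) (F : set_system T) {FF : Filter F} (u : T -> X)
  (y : X) : u @ F --> y -> sqnorm (u t - y) @[t --> F] --> (0 : R).
Proof.
move=> /cvgrPdist_lt H; apply/cvgrPdist_lt => e e0.
have e2 : 0 < Num.sqrt e by rewrite sqrtr_gt0.
have := H (Num.sqrt e)%:C%C; rewrite ltcR => /(_ e2).
apply: filterS => t; rewrite sub0r normrN ger0_norm ?sqnorm_ge0//.
by rewrite distrC -sqnorm_lt// sqr_sqrtr// ltW.
Qed.

Lemma sqnorm_cauchy_cvg (u : X^nat) :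
  (forall e : R, 0 < e -> exists N, forall m n, (N <= m)%N -> (N <= n)%N ->
    sqnorm (u m - u n) < e) -> cvg (u @ \oo).
Proof.
move=> H; apply: cauchy_cvg; apply/cauchy_ballP => _ /complex_gt0P[e e0 ->].
have [|N HN] := H (e ^+ 2); first exact: exprn_gt0.
pose S := [set u n | n in [set n | (N <= n)%N]].
exists (S, S) => /=; first by split; exists N => // n /= Nn; exists n.
move=> [_ _] /= [[m Nm <-] [n Nn <-]]; rewrite -ball_normE/= -sqnorm_lt//.
exact: HN.
Qed.

(** Cauchy-Schwarz applied to [u t - y] and [g], compared through squares. *)
Lemma rdot_cvg (T : Type) (F : set_system T) {FF : Filter F} (u : T -> X)
  (y g : X) : u @ F --> y -> rdot (u t) g @[t --> F] --> rdot y g.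
Proof.
move=> /sqnorm_cvg uy.
have h : (sqnorm (u t - y) * sqnorm g) @[t --> F] --> (0 : R).
  by rewrite -(mul0r (sqnorm g)); apply: cvgMr_tmp.
move/cvgrPdist_lt : h => H; apply/cvgrPdist_lt => e e0.
have e2 : 0 < e ^+ 2 by rewrite exprn_gt0.
apply: filterS (H _ e2) => t.
rewrite sub0r normrN ger0_norm ?mulr_ge0 ?sqnorm_ge0// => lt.
have := le_lt_trans (rdot_CauchySchwarz _ _) lt.
rewrite -(real_normK (num_real _)) ltr_pXn2r// ?nnegrE ?(ltW e0)//.
by rewrite rdotDl rdotNl distrC.
Qed.

Lemma sqnorm_cvg_val (T : Type) (F : set_system T) {FF : Filter F} (u : T -> X)
  (y : X) : u @ F --> y -> sqnorm (u t) @[t --> F] --> sqnorm y.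
Proof.
move=> uy.
have -> : (fun t => sqnorm (u t)) =
    (fun t => sqnorm (u t - y) + 2 * rdot (u t) y - sqnorm y).
  by apply/funext => t; rewrite sqnormB; lra.
rewrite [X in _ --> X](_ : _ = 0 + 2 * rdot y y - sqnorm y); last first.
  by rewrite /sqnorm; lra.
apply: cvgB; last exact: cvg_cst.
apply: cvgD; first exact: sqnorm_cvg.
by apply: cvgMl_tmp; exact: rdot_cvg.
Qed.

Lemma dense_sqnorm_approx (S : set X) (y : X) (e : R) : dense S -> 0 < e ->
  exists2 x, S x & sqnorm (y - x) < e.
Proof.
move=> dS e0; have e2 : 0 < Num.sqrt e by rewrite sqrtr_gt0.
have [| |x [bx Sx]] := dS (ball y (Num.sqrt e)%:C%C).
- by exists y; apply: ballxx; rewrite ltcR.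
- by apply: ball_open; rewrite ltcR.
exists x => //; move: bx; rewrite -ball_normE/= -sqnorm_lt//.
by rewrite sqr_sqrtr// ltW.
Qed.

Lemma dense_sqnorm_unbounded (S : set X) (c : R) : (exists x : X, x != 0) ->
  dense S -> exists2 x, S x & c < sqnorm x.
Proof.
move=> [x x0] dS.
have xp : 0 < sqnorm x.
  rewrite lt_def sqnorm_ge0 andbT; apply: contra x0 => /eqP/sqnorm_eq0 ->//.
(* The multiple of [x] of squared norm [4 (|c| + 1)]: a point [y] of [S] at squared distance below 1
   satisfies [4 (|c| + 1) < 2 + 2 |y|^2], hence [|y|^2 > c]. *)
pose a := Num.sqrt ((`|c| + 1) * 4 / sqnorm x).
have a2 : sqnorm (a%:C%C *: x) = (`|c| + 1) * 4.
  rewrite sqnormZ normc_sqr/= expr0n/= addr0 sqr_sqrtr; last first.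
    by rewrite divr_ge0 ?sqnorm_ge0// mulr_ge0// addr_ge0.
  by rewrite divfK// gt_eqF.
have [y Sy yx] := dense_sqnorm_approx (a%:C%C *: x) dS ltr01.
exists y => //.
have := sqnormB_triangle (a%:C%C *: x) y 0; rewrite !subr0 a2.
have := ler_norm c; have := normr_ge0 c; lra.
Qed.

Lemma dense_sqnorm_small (S : set X) (c : R) : 0 < c ->
  dense S -> exists2 x, S x & sqnorm x < c.
Proof.
move=> c0 dS; have [y Sy] := dense_sqnorm_approx 0 dS c0.
by rewrite sqnormBC subr0; exists y.
Qed.

End SquaredNorm.

(** * Orbits of normal operators *)

Section LogConvex.
Variables (R : realType) (a : nat -> R).
Hypothesis a_ge0 : forall n, 0 <= a n.
Hypothesis a_logconvex : forall n, a n.+1 ^+ 2 <= a n * a n.+2.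

(** A strict increase persists: [a n.+2 <= a n.+1] would give [a n * a n.+2 <= a n * a n.+1 < a n.+1
    ^+ 2], against log-convexity. *)
Lemma logconvex_lt_succ n : a n < a n.+1 -> a n.+1 < a n.+2.
Proof.
move=> lt_an; rewrite ltNge; apply/negP => le_an.
have an1 : 0 < a n.+1 by exact: le_lt_trans lt_an.
have : a n * a n.+2 < a n.+1 ^+ 2.
  apply: (@le_lt_trans _ _ (a n * a n.+1)); first by rewrite ler_wpM2l.
  by rewrite expr2 ltr_pM2r.
by rewrite ltNge a_logconvex.
Qed.

Lemma logconvex_gt0 n : 0 < a n.+1 -> 0 < a n.
Proof.
move=> an1; rewrite lt_def a_ge0 andbT; apply/eqP => an0.
have := a_logconvex n; rewrite an0 mul0r leNgt => /negP; apply.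
by rewrite exprn_gt0.
Qed.

(** Without any strict increase, [a 0] is an upper bound. Otherwise the sequence increases from some
    [N] on, and the minimum of its terms up to [N] is a lower bound; it is positive because
    positivity passes from a term to the previous one. *)
Lemma logconvex_bounded :
  (exists2 c, 0 < c & forall n, c <= a n) \/ (exists C, forall n, a n <= C).
Proof.
have [[N ltN]|nN] := pselect (exists N, a N < a N.+1); last first.
  right; exists (a 0); elim=> // n IHn; apply: le_trans IHn.
  by rewrite leNgt; apply/negP => lt_an; apply: nN; exists n.
left.
have aNgt0 : 0 < a N by apply: logconvex_gt0; exact: le_lt_trans ltN.
have [c c0 cN] : exists2 c, 0 < c & forall i, (i <= N)%N -> c <= a i.
  elim: N aNgt0 {ltN} => [a0 | N IHN aN1].
    by exists (a 0) => // i; rewrite leqn0 => /eqP ->.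
  have [c c0 cN] := IHN (logconvex_gt0 aN1).
  exists (Num.min c (a N.+1)); first by rewrite lt_min c0.
  move=> i; rewrite leq_eqVlt => /predU1P[-> |iN].
    by rewrite ge_min lexx orbT.
  by rewrite ge_min cN.
have aN k : a N <= a (N + k)%N /\ a (N + k)%N < a (N + k).+1.
  elim: k => [|k [le_ak lt_ak]]; first by rewrite addn0.
  rewrite addnS; split; last exact: logconvex_lt_succ.
  exact: le_trans (ltW lt_ak).
exists c => // n; have [/cN//|Nn] := leqP n N.
rewrite -(subnKC (ltnW Nn)); apply: le_trans (aN _).1; exact: cN.
Qed.

End LogConvex.

Section LinearOperator.
Variables (K : numFieldType) (X : normedModType K) (A : operator X).
Hypothesis linA : is_linear_op A.

Lemma linear_op0 : A 0 = 0.
Proof.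
have [A0 /(_ 1 0 0 A0 A0)[_]] := linA.
by rewrite scaler0 add0r scale1r => /esym/eqP; rewrite -subr_eq0 addrK => /eqP.
Qed.

Lemma linear_opD f g : dom A f -> dom A g ->
  dom A (f + g) /\ A (f + g) = A f + A g.
Proof. by move=> Af Ag; have := linA.2 1 f g Af Ag; rewrite !scale1r. Qed.

Lemma linear_opZ a f : dom A f -> dom A (a *: f) /\ A (a *: f) = a *: A f.
Proof.
move=> Af; have := linA.2 a f 0 Af linA.1.
by rewrite !addr0 linear_op0 addr0.
Qed.

End LinearOperator.

Section Normal.
Variables (R : realType) (X : hilbertType R) (A : operator X).

Lemma adjointP g : dom (adjoint A) g ->
  forall f, dom A f -> inner (A f) g = inner f (adjoint A g).
Proof.
case=> h hP.
exact: (@getPex _ [set h | forall f, dom A f -> inner (A f) g = inner f h]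
  (ex_intro _ h hP)).
Qed.

(** * Minimisation of the regularised distance to a vector *)

Section Minimization.
Hypothesis linA : is_linear_op A.
Hypothesis closedA : closed_op A.
Variables (e : R) (h : X).
Hypothesis e_gt0 : 0 < e.

(** The Tikhonov functional, whose minimiser [u] solves [e A^* A u + u = h]. *)
Definition graph_energy v : R := sqnorm (v - h) + e * sqnorm (A v).

Lemma graph_energy_ge0 v : 0 <= graph_energy v.
Proof. by rewrite addr_ge0 ?mulr_ge0 ?sqnorm_ge0// ltW. Qed.

(** The parallelogram law in the graph norm, at the midpoint [m] of [v] and [w]. It forces
    minimising sequences to be Cauchy. *)
Lemma graph_energy_parallelogram v w : dom A v -> dom A w ->
  exists2 m, dom A m &
  graph_energy v + graph_energy w =
  2 * graph_energy m + 2^-1 * (sqnorm (v - w) + e * sqnorm (A v - A w)).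
Proof.
move=> Av Aw; have [Avw AvwE] := linear_opD linA Av Aw.
have [Am AmE] := linear_opZ linA (2^-1)%:C%C Avw.
exists ((2^-1)%:C%C *: (v + w)) => //.
rewrite /graph_energy AmE AvwE !sqnormB !sqnormZ !normc_sqr/= expr0n/= addr0.
by rewrite !sqnormD rdotZl !rdotDl; field.
Qed.

(** The direct method: along a minimising sequence both [v_ n] and [A (v_ n)] are Cauchy, and
    closedness of the graph puts the pair of limits in it. *)
Lemma graph_energy_min : exists2 u, dom A u &
  forall v, dom A v -> graph_energy u <= graph_energy v.
Proof.
pose S := [set graph_energy v | v in dom A].
have hS : has_inf S.
  split; first by exists (graph_energy 0); exists 0 => //; case: linA.
  by exists 0 => _ [v _ <-]; exact: graph_energy_ge0.
have dS v : dom A v -> inf S <= graph_energy v.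
  by move=> Av; apply: ge_inf; [case: hS | exists v].
have /choice[v_ v_P] : forall n : nat, exists v,
    dom A v /\ graph_energy v < inf S + n.+1%:R^-1.
  move=> n; have n0 : (0 : R) < n.+1%:R^-1 by rewrite invr_gt0.
  by have [_ [v Av <-] lt] := inf_adherent n0 hS; exists v.
(* Both energies are within [1 / (N + 1)] of the infimum and the midpoint has at least the infimum,
   so half of the left-hand side is below [2 / (N + 1)]. *)
have close N m n : (N <= m)%N -> (N <= n)%N ->
    sqnorm (v_ m - v_ n) + e * sqnorm (A (v_ m) - A (v_ n)) < 4 * N.+1%:R^-1.
  move=> Nm Nn; have [Am lm] := v_P m; have [An ln] := v_P n.
  have [p Ap] := graph_energy_parallelogram Am An.
  have := dS _ Ap.
  have im : m.+1%:R^-1 <= N.+1%:R^-1 :> R by rewrite lef_pV2 ?posrE ?ler_nat.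
  have in' : n.+1%:R^-1 <= N.+1%:R^-1 :> R by rewrite lef_pV2 ?posrE ?ler_nat.
  move: lm ln im in'; move: (m.+1%:R^-1) (n.+1%:R^-1) (N.+1%:R^-1) => x y z.
  lra.
have small (c : R) : 0 < c -> exists N, 4 * N.+1%:R^-1 < c.
  move=> c0; have c4 : 0 < c / 4 by rewrite divr_gt0.
  have [N _ NP] := near_infty_natSinv_lt (PosNum c4).
  exists N; have /= := NP N (leqnn _); move: (N.+1%:R^-1) => x; lra.
have cu : cvg (v_ @ \oo).
  apply: sqnorm_cauchy_cvg => c c0; have [N Nc] := small c c0.
  exists N => m n Nm Nn; apply: le_lt_trans (lt_trans (close _ _ _ Nm Nn) Nc).
  by rewrite lerDl mulr_ge0 ?sqnorm_ge0// ltW.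
have cw : cvg ((A \o v_) @ \oo).
  apply: sqnorm_cauchy_cvg => c c0.
  have [N Nc] := small (e * c) (mulr_gt0 e_gt0 c0).
  exists N => m n Nm Nn; rewrite -(ltr_pM2l e_gt0).
  apply: le_lt_trans (lt_trans (close _ _ _ Nm Nn) Nc).
  by rewrite lerDr sqnorm_ge0.
set u := lim (v_ @ \oo) in cu; set w := lim ((A \o v_) @ \oo) in cw.
have [Au Aw] : dom A u /\ w = A u.
  have cp : (v_ n, A (v_ n)) @[n --> \oo] --> (u, w) by exact: cvg_pair.
  suff : [set p : X * X | dom A p.1 /\ p.2 = A p.1] (u, w) by [].
  apply: (closed_cvg _ closedA _ _ cp).
  by apply: nearW => n /=; split => //; exact: (v_P n).1.
exists u => // v /dS; apply: le_trans; rewrite /graph_energy -Aw.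
have cE : graph_energy (v_ n) @[n --> \oo] --> sqnorm (u - h) + e * sqnorm w.
  apply: cvgD.
    by apply: sqnorm_cvg_val; apply: cvgB => //; exact: cvg_cst.
  by apply: cvgMl_tmp; apply: sqnorm_cvg_val; exact: cw.
have cI : inf S + n.+1%:R^-1 @[n --> \oo] --> inf S + 0.
  by apply: cvgD; [exact: cvg_cst | exact: cvg_harmonic].
rewrite -[X in _ <= X]addr0.
apply: (ler_cvg_to cE cI).
by apply: nearW => n; apply/ltW; exact: (v_P n).2.
Qed.

Lemma quadratic_ge0_eq0 (b c : R) : 0 <= c ->
  (forall t, 0 <= 2 * t * b + t ^+ 2 * c) -> b = 0.
Proof.
(* Near the vertex of the parabola; the denominator [c + 1] stays positive when [c = 0]. *)
move=> c0 /(_ (- b / (c + 1))).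
have c1 : 0 < c + 1 by lra.
have -> : 2 * (- b / (c + 1)) * b + (- b / (c + 1)) ^+ 2 * c =
    - ((c + 2) * (b / (c + 1)) ^+ 2) by field; rewrite gt_eqF.
rewrite oppr_ge0 pmulr_rle0; last lra.
move=> le0; apply/eqP; rewrite -(mulIr_eq0 _ (@mulIf _ (c + 1)^-1 _)).
  by rewrite -sqrf_eq0 eq_le le0 sqr_ge0.
by rewrite invr_eq0 gt_eqF.
Qed.

(** The Euler-Lagrange equation, from the first variation of the energy at [u] in the direction [v].
    It exhibits [A u] in the domain of the adjoint, with [(h - u) / e] as value. *)
Lemma graph_energy_min_orthogonal u : dom A u ->
  (forall v, dom A v -> graph_energy u <= graph_energy v) ->
  forall v, dom A v -> inner (A v) (A u) = inner v ((e^-1)%:C%C *: (h - u)).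
Proof.
move=> Au umin.
have re v : dom A v -> rdot v (u - h) + e * rdot (A v) (A u) = 0.
  move=> Av; apply: (@quadratic_ge0_eq0 _ (sqnorm v + e * sqnorm (A v))).
    by rewrite addr_ge0 ?mulr_ge0 ?sqnorm_ge0// ltW.
  move=> t; have [At AtE] := linear_opZ linA t%:C%C Av.
  have [Aut AutE] := linear_opD linA Au At.
  have := umin _ Aut.
  rewrite -subr_ge0 /graph_energy AutE AtE (addrAC u _ (- h)).
  rewrite !(sqnormD _ (t%:C%C *: _)) !sqnormZ !normc_sqr/= expr0n/= addr0.
  rewrite !rdotZr [rdot v _]rdotC [rdot (A v) _]rdotC.
  by congr (_ <= _); ring.
(* [re] at ['i *: v] controls the imaginary part. *)
move=> v Av; have [Ai AiE] := linear_opZ linA 'i%C Av.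
have := re _ Ai; rewrite AiE /rdot !linearZl_LR/= !Re_mul/= !mul0r !mul1r.
have := re _ Av; rewrite /rdot.
set z := inner (A v) (A u) => reE imE.
rewrite innerZr_real -(opprB u h) innerNr.
move: reE imE; case: z (inner _ _) => [a b] [c d]/= reE imE.
have e0 : e != 0 by rewrite gt_eqF.
by apply/eqP; rewrite eq_complex/=; apply/andP; split; apply/eqP;
  apply: (mulfI e0); rewrite mul0r ?subr0 ?addr0 mulrA divff// mul1r; lra.
Qed.

End Minimization.

Hypothesis normalA : normal_op A.

(** Both squared norms equal the real part of [(u, A^* A u) = (u, A A^* u)]. *)
Lemma normal_sqnorm_adjoint u : dom A u -> dom (adjoint A) (A u) ->
  dom (adjoint A) u /\ sqnorm (adjoint A u) = sqnorm (A u).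
Proof.
have [_ _ _ [domE valE]] := normalA => Au AAu.
have uD : dom (op_comp (adjoint A) A) u by [].
have [Asu AAsu] : dom (op_comp A (adjoint A)) u by rewrite -domE.
split => //; have E : adjoint A (A u) = A (adjoint A u) := valE _ uD.
rewrite /sqnorm /rdot (adjointP AAu Au) E.
by rewrite [RHS]rdotC -/(rdot _ _) /rdot (adjointP Asu AAsu).
Qed.

(** The minimiser [u] has at most the energy of the competitor [g], that is
    [|u - g|^2 + e |A u|^2 <= e |A g|^2]; each term on the left gives one bound. *)
Lemma normal_resolvent_approx (g : X) (e : R) : dom A g -> 0 < e ->
  exists2 u, dom (adjoint A) u &
    sqnorm (u - g) <= e * sqnorm (A g) /\
    sqnorm (adjoint A u) <= sqnorm (A g).
Proof.
move=> Ag e0; have [linA _ closedA _] := normalA.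
have [u Au umin] := graph_energy_min linA closedA g e0.
have AAu : dom (adjoint A) (A u).
  exists ((e^-1)%:C%C *: (g - u)) => v Av.
  exact: graph_energy_min_orthogonal Av.
have [Asu AsE] := normal_sqnorm_adjoint Au AAu.
exists u => //; rewrite AsE; have := umin _ Ag.
rewrite /graph_energy subrr sqnorm0 add0r => le_u; split.
  by have := mulr_ge0 (ltW e0) (sqnorm_ge0 (A u)); lra.
by rewrite -(ler_pM2l e0); have := sqnorm_ge0 (u - g); lra.
Qed.

(** Since [A f] is not known to lie in the domain of the adjoint, it is approached by [u_ n] from
    that domain with [|A^* (u_ n)| <= |A (A f)|]. Then [(u_ n, A f)] and [(A^* (u_ n), f)] have the
    same real part, and Cauchy-Schwarz passes to the limit. *)
Lemma normal_logconvex f : dom A f -> dom A (A f) ->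
  sqnorm (A f) ^+ 2 <= sqnorm f * sqnorm (A (A f)).
Proof.
move=> Af AAf; pose c := sqnorm (A (A f)).
have /choice[u_ u_P] : forall n : nat, exists u, [/\ dom (adjoint A) u,
    sqnorm (u - A f) <= n.+1%:R^-1 * c & sqnorm (adjoint A u) <= c].
  move=> n; have n0 : (0 : R) < n.+1%:R^-1 by rewrite invr_gt0.
  by have [u Au [? ?]] := normal_resolvent_approx AAf n0; exists u.
have cu : u_ @ \oo --> A f.
  apply: cvg_sqnorm.
  have c0 : n.+1%:R^-1 * c @[n --> \oo] --> (0 : R).
    by rewrite -(mul0r c); apply: cvgMr_tmp; exact: cvg_harmonic.
  apply: (squeeze_cvgr _ (cvg_cst 0) c0).
  by apply: nearW => n; rewrite sqnorm_ge0/=; case: (u_P n).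
have cr := rdot_cvg (g := A f) cu.
have cr2 : rdot (u_ n) (A f) ^+ 2 @[n --> \oo] --> sqnorm (A f) ^+ 2.
  by apply: cvgM; exact: cr.
apply: (cvgr_to_le cr2).
apply: nearW => n; have [Au _ le_c] := u_P n.
have -> : rdot (u_ n) (A f) = rdot f (adjoint A (u_ n)).
  by rewrite rdotC /rdot adjointP.
apply: le_trans (rdot_CauchySchwarz _ _) _.
by rewrite ler_wpM2l// sqnorm_ge0.
Qed.

Lemma normal_not_hypercyclic : (exists x : X, x != 0) -> ~ hypercyclic A.
Proof.
move=> X0 [f [_ Cf df]].
(* Membership of [f] in the domain of the power [n.+1] says that [A] applies to the iterate of order
   [n]. *)
have dA n : dom A (op_pow A n f) by have [] := Cf n.+1 I.
pose a n := sqnorm (op_pow A n f).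
have a0 n : 0 <= a n by exact: sqnorm_ge0.
have a2 n : a n.+1 ^+ 2 <= a n * a n.+2.
  by apply: normal_logconvex; [exact: dA | exact: (dA n.+1)].
have [[c c0 cP]|[C CP]] := logconvex_bounded a0 a2.
- have [_ [n _ <-] lt_c] := dense_sqnorm_small c0 df.
  by have := cP n; rewrite leNgt lt_c.
- have [_ [n _ <-] lt_C] := dense_sqnorm_unbounded C X0 df.
  by have := CP n; rewrite leNgt lt_C.
Qed.

End Normal.

(** * Borel functions of a complex variable *)

Section ComplexBorel.
Variable R : realType.

Lemma normc_ge_Im (z : R[i]) : `|complex.Im z|%:C%C <= `|z|.
Proof.
rewrite normc_def lecR -sqrtr_sqr ler_sqrt ?addr_ge0 ?sqr_ge0//.
by rewrite lerDr sqr_ge0.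
Qed.

Lemma continuous_Re : continuous (@complex.Re R : (R[i])^o -> R).
Proof.
move=> z; have FF : Filter (nbhs z) by exact: nbhs_filter.
apply/cvgrPdist_lt => e e0.
have e0' : (0 : R[i]) < e%:C%C by rewrite ltcR.
have := @nbhsx_ballx _ (R[i])^o z _ e0'; apply: filterS => w.
rewrite -ball_normE/= => lt.
rewrite -Re_opp -Re_add -ltcR.
by apply: le_lt_trans lt; exact: normc_ge_Re.
Qed.

Lemma continuous_Im : continuous (@complex.Im R : (R[i])^o -> R).
Proof.
move=> z; have FF : Filter (nbhs z) by exact: nbhs_filter.
apply/cvgrPdist_lt => e e0.
have e0' : (0 : R[i]) < e%:C%C by rewrite ltcR.
have := @nbhsx_ballx _ (R[i])^o z _ e0'; apply: filterS => w.
rewrite -ball_normE/= => lt.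
rewrite -Im_opp -Im_add -ltcR.
by apply: le_lt_trans lt; exact: normc_ge_Im.
Qed.

Lemma open_measurable_borelC (U : set (R[i])^o) :
  open U -> measurable (U : set (borelC R)).
Proof. by move=> oU; apply: sub_sigma_algebra. Qed.

Lemma continuous_measurable_borelC (g : (R[i])^o -> R) :
  continuous g -> measurable_fun setT (g : borelC R -> R).
Proof.
move=> cg; apply: (measurability _ (RGenOInfty.measurableE R)).
move=> /= _ [_ [a ->] <-]; rewrite setTI.
apply: open_measurable_borelC; by apply: open_comp => //; exact: interval_open.
Qed.

Lemma measurable_Re : measurable_fun setT (@complex.Re R : borelC R -> R).
Proof. exact: continuous_measurable_borelC continuous_Re. Qed.

Lemma measurable_Im : measurable_fun setT (@complex.Im R : borelC R -> R).
Proof. exact: continuous_measurable_borelC continuous_Im. Qed.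

(** Testing the two real parts separately reduces measurability to functions with values in [R]. *)
Definition cmeasurable (F : borelC R -> R[i]) : Prop :=
  measurable_fun setT (fun z => complex.Re (F z)) /\
  measurable_fun setT (fun z => complex.Im (F z)).

Lemma cmeasurable_id : cmeasurable id.
Proof. by split; [exact: measurable_Re | exact: measurable_Im]. Qed.

Lemma cmeasurable_cst c : cmeasurable (fun=> c).
Proof. by split; exact: measurable_cst. Qed.

Lemma cmeasurableD F G :
  cmeasurable F -> cmeasurable G -> cmeasurable (fun z => F z + G z).
Proof.
move=> [rF iF] [rG iG]; split.
  by under eq_fun do rewrite Re_add; exact: measurable_funD.
by under eq_fun do rewrite Im_add; exact: measurable_funD.
Qed.

Lemma cmeasurableM F G :
  cmeasurable F -> cmeasurable G -> cmeasurable (fun z => F z * G z).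
Proof.
move=> [rF iF] [rG iG]; split.
  by under eq_fun do rewrite Re_mul; apply: measurable_funB;
    exact: measurable_funM.
by under eq_fun do rewrite Im_mul; apply: measurable_funD;
  exact: measurable_funM.
Qed.

Lemma cmeasurableZ c F : cmeasurable F -> cmeasurable (fun z => c * F z).
Proof. by move=> mF; exact: cmeasurableM (cmeasurable_cst c) mF. Qed.

Lemma cmeasurableB F G :
  cmeasurable F -> cmeasurable G -> cmeasurable (fun z => F z - G z).
Proof.
move=> mF /(cmeasurableZ (-1)) mG; have := cmeasurableD mF mG.
by congr cmeasurable; apply/funext => z; rewrite mulN1r.
Qed.

Lemma cmeasurable_indic (B : set (borelC R)) :
  measurable B -> cmeasurable (\1_B : borelC R -> R[i]).
Proof.
move=> mB; split.
  rewrite [X in measurable_fun _ X](_ : _ = \1_B) ?measurable_indic//.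
  by apply/funext => z; rewrite !indicE; case: (z \in B).
rewrite [X in measurable_fun _ X](_ : _ = cst 0); first exact: measurable_cst.
by apply/funext => z; rewrite !indicE; case: (z \in B).
Qed.

Lemma measurable_normc_sqr (D : set (borelC R)) F : cmeasurable F ->
  measurable_fun D (fun z => (Normc.normc (F z) ^+ 2)%:E).
Proof.
move=> [rF iF]; apply/measurable_EFinP.
under eq_fun do rewrite normc_sqr.
apply: (measurable_funS measurableT) => //.
by apply: measurable_funD; exact: measurable_funX.
Qed.

End ComplexBorel.

(** * Approximation of Borel functions by simple functions *)

Section SimpleFunctions.
Import HBSimple HBNNSimple.
Variable R : realType.
Implicit Types s r : simple_fct R.

Lemma cmeasurable_sum (I : Type) (l : seq I) (F : I -> borelC R -> R[i]) :
  (forall i, cmeasurable (F i)) -> cmeasurable (fun z => \sum_(i <- l) F i z).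
Proof.
move=> mF; elim: l => [|i l IHl].
  by under eq_fun do rewrite big_nil; exact: cmeasurable_cst.
by under eq_fun do rewrite big_cons; exact: cmeasurableD.
Qed.

Lemma cmeasurable_sf s : cmeasurable (sf_eval s).
Proof.
apply: cmeasurable_sum => k; apply: cmeasurableZ; apply: cmeasurable_indic.
exact: sf_measurable.
Qed.

(** The function [c s + r], by concatenating the two families of sets; as these may overlap, no
    common refinement is formed. *)
Definition sf_comb (c : R[i]) s r : simple_fct R :=
  @SimpleFct R (sf_size s + sf_size r)
    (fun k => match fintype.split k with
              | inl i => c * sf_coef i | inr j => sf_coef j end)
    (fun k => match fintype.split k with
              | inl i => sf_set i | inr j => sf_set j end)
    (fun k => match fintype.split k as x return
       measurable match x with inl i => sf_set i | inr j => sf_set j end with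
       | inl i => sf_measurable i | inr j => sf_measurable j end).

(** Stated for an arbitrary summand [g] so as to serve both for pointwise values and for spectral
    integrals. *)
Lemma sf_comb_sum (V : zmodType) c s r (g : R[i] -> set (borelC R) -> V) :
  \sum_(k < sf_size (sf_comb c s r))
    g (sf_coef (s := sf_comb c s r) k) (sf_set (s := sf_comb c s r) k) =
  \sum_(k < sf_size s) g (c * sf_coef k) (sf_set k) +
  \sum_(k < sf_size r) g (sf_coef k) (sf_set k).
Proof.
rewrite big_split_ord/=; congr (_ + _); apply: eq_bigr => k _.
  by rewrite -[lshift _ k]/(unsplit (inl k)) unsplitK.
by rewrite -[rshift _ k]/(unsplit (inr k)) unsplitK.
Qed.

Lemma sf_comb_eval c s r z :
  sf_eval (sf_comb c s r) z = c * sf_eval s z + sf_eval r z.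
Proof.
rewrite /sf_eval (sf_comb_sum c s r (fun x B => x * \1_B z)) mulr_sumr.
by congr (_ + _); apply: eq_bigr => k _; rewrite mulrA.
Qed.

Definition sf_restr s (B : set (borelC R)) (mB : measurable B) : simple_fct R :=
  @SimpleFct R (sf_size s) (@sf_coef R s) (fun k => sf_set k `&` B)
    (fun k => measurableI _ _ (sf_measurable k) mB).

Lemma sf_restr_eval s B (mB : measurable B) z :
  sf_eval (sf_restr s mB) z = sf_eval s z * \1_B z.
Proof.
rewrite /sf_eval mulr_suml; apply: eq_bigr => k _ /=.
by rewrite indicI mulrA.
Qed.

Definition sf_indic (B : set (borelC R)) (mB : measurable B) : simple_fct R :=
  @SimpleFct R 1 (fun=> 1) (fun=> B) (fun=> mB).

Lemma sf_indic_eval B (mB : measurable B) z : sf_eval (sf_indic mB) z = \1_B z.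
Proof. by rewrite /sf_eval big_ord_recl big_ord0 addr0 mul1r. Qed.

Lemma nnsfun_simple_fct (g : {nnsfun borelC R >-> R}) :
  exists s, forall z, sf_eval s z = (g z)%:C%C.
Proof.
pose l := finmap.enum_fset (fset_set (g @` setT)).
have mg (k : 'I_(size l)) : measurable (g @^-1` [set l`_k]).
  exact: measurable_funPTI.
exists (@SimpleFct R (size l) (fun k => (l`_k)%:C%C)
  (fun k => g @^-1` [set l`_k]) mg) => z.
rewrite fimfunEord rmorph_sum; apply: eq_bigr => k _ /=.
by rewrite rmorphM/= !indicE; case: (_ \in _).
Qed.

Lemma ge0_simple_approx (h : borelC R -> R) : measurable_fun setT h ->
  (forall z, 0 <= h z) -> exists s : (simple_fct R)^nat,
  [/\ forall n z, complex.Im (sf_eval (s n) z) = 0,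
      forall n z, 0 <= complex.Re (sf_eval (s n) z) <= h z
    & forall z, complex.Re (sf_eval (s n) z) @[n --> \oo] --> h z].
Proof.
move=> mh h0.
have mh' : measurable_fun setT (EFin \o h) by exact/measurable_EFinP.
pose g := nnsfun_approx measurableT mh'.
have cg z : (g n z) @[n --> \oo] --> h z.
  have h0' x : setT x -> (0 <= (EFin \o h) x)%E by rewrite lee_fin.
  by have /fine_cvgP[_] := cvg_nnsfun_approx measurableT mh' h0' (I : setT z).
have ndg z : nondecreasing_seq (fun n => g n z).
  by move=> m n mn; have /lefP := nd_nnsfun_approx measurableT mh' mn; exact.
have /choice[s sP] := fun n => nnsfun_simple_fct (g n).
exists s; split => [n z|n z|z]; rewrite ?sP//=; last first.
  by under eq_fun do rewrite sP; exact: cg.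
apply/andP; split; first exact: fun_ge0.
have <- := cvg_lim (@Rhausdorff R) (cg z).
apply: nondecreasing_cvgn_le; first exact: ndg.
by apply/cvg_ex; exists (h z).
Qed.

(** The positive and negative parts of [h] are approximated from below. At each point one of them
    vanishes, and so does its approximation, hence the bound by [|h|]. *)
Lemma real_simple_approx (h : borelC R -> R) : measurable_fun setT h ->
  exists s : (simple_fct R)^nat,
  [/\ forall n z, complex.Im (sf_eval (s n) z) = 0,
      forall n z, `|complex.Re (sf_eval (s n) z)| <= `|h z|
    & forall z, complex.Re (sf_eval (s n) z) @[n --> \oo] --> h z].
Proof.
move=> mh.
have [||p [p0 pP pc]] := @ge0_simple_approx (h^\+).
- exact: measurable_funrpos.
- by move=> z; exact: funrpos_ge0.
have [||q [q0 qP qc]] := @ge0_simple_approx (h^\-).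
- exact: measurable_funrneg.
- by move=> z; exact: funrneg_ge0.
have sE n z : sf_eval (sf_comb (-1) (q n) (p n)) z =
    sf_eval (p n) z - sf_eval (q n) z by rewrite sf_comb_eval mulN1r addrC.
exists (fun n => sf_comb (-1) (q n) (p n)); split.
- by move=> n z; rewrite sE Im_add Im_opp p0 q0 subr0.
- move=> n z; rewrite sE Re_add Re_opp.
  have /andP[p1 p2] := pP n z; have /andP[q1 q2] := qP n z.
  move: p2 q2; rewrite /funrpos /funrneg/=.
  have [h0|/ltW h0] := leP 0 (h z).
    have hN : - h z <= 0 by rewrite oppr_le0.
    by rewrite (max_r hN) (ger0_norm h0) => p2 q2; rewrite ger0_norm; lra.
  have hN : 0 <= - h z by rewrite oppr_ge0.
  by rewrite (max_l hN) (ler0_norm h0) => p2 q2; rewrite ler0_norm; lra.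
- move=> z; under eq_fun do rewrite sE Re_add Re_opp.
  have -> : h z = h^\+ z - h^\- z by rewrite -[in LHS](funrposBneg h).
  by apply: cvgB.
Qed.

(** The bound by [|F|] supplies the majorant for dominated convergence. *)
Lemma complex_simple_approx (F : borelC R -> R[i]) : cmeasurable F ->
  exists s : (simple_fct R)^nat,
  [/\ forall n z, Normc.normc (sf_eval (s n) z) ^+ 2 <= Normc.normc (F z) ^+ 2,
      forall z, complex.Re (sf_eval (s n) z) @[n --> \oo] --> complex.Re (F z)
    & forall z, complex.Im (sf_eval (s n) z) @[n --> \oo] --> complex.Im (F z)].
Proof.
move=> [/real_simple_approx[p [p0 pP pc]] /real_simple_approx[q [q0 qP qc]]].
have rE n z : complex.Re (sf_eval (sf_comb 'i%C (q n) (p n)) z) =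
    complex.Re (sf_eval (p n) z).
  by rewrite sf_comb_eval Re_add Re_mul/= q0 mul0r mulr0 subrr add0r.
have iE n z : complex.Im (sf_eval (sf_comb 'i%C (q n) (p n)) z) =
    complex.Re (sf_eval (q n) z).
  by rewrite sf_comb_eval Im_add Im_mul/= p0 mul0r mul1r add0r addr0.
exists (fun n => sf_comb 'i%C (q n) (p n)); split.
- move=> n z; rewrite !normc_sqr rE iE lerD//.
    rewrite -[leLHS]real_normK ?num_real// -[leRHS]real_normK ?num_real//.
    by rewrite lerXn2r ?nnegrE.
  rewrite -[leLHS]real_normK ?num_real// -[leRHS]real_normK ?num_real//.
  by rewrite lerXn2r ?nnegrE.
- by move=> z; under eq_fun do rewrite rE; exact: pc.
- by move=> z; under eq_fun do rewrite iE; exact: qc.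
Qed.

End SimpleFunctions.

(** * The finite measures [(E(.) f, f)] *)

Section SpectralMassTheory.
Variables (R : realType) (X : hilbertType R) (E : spectral_measure X).
Implicit Types (f g : X) (B : set (borelC R)).

Lemma proj_linear B : measurable B ->
  forall a f g, E B (a *: f + g) = a *: E B f + E B g.
Proof. by move=> mB; have [lB _ _] := proj_orthogonal E mB. Qed.

Lemma inner_proj B B' f : measurable B -> measurable B' ->
  inner (E B f) (E B' f) = (sqnorm (E (B `&` B') f))%:C%C.
Proof.
move=> mB mB'; have [_ _ sB'] := proj_orthogonal E mB'.
have mI : measurable (B `&` B') by exact: measurableI.
have [_ iI sI] := proj_orthogonal E mI.
rewrite -sB' -proj_setI// setIC sqnormE -inner_norm.
by rewrite -{1}iI sI.
Qed.

Lemma spectral_massE B f : measurable B ->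
  spectral_mass E f B = (sqnorm (E B f))%:E.
Proof.
move=> mB; rewrite /spectral_mass; congr (_%:E).
have -> : inner (E B f) f = (sqnorm (E B f))%:C%C.
  have [_ iB sB] := proj_orthogonal E mB.
  by rewrite sqnormE -inner_norm -{1}iB sB.
by rewrite /= expr0n/= addr0 sqrtr_sqr ger0_norm// sqnorm_ge0.
Qed.

Lemma spectral_mass_finite f : fin_num_fun (spectral_mass E f).
Proof. by []. Qed.

HB.instance Definition _ f := Measure_isFinite.Build _ _ _
  (spectral_mass E f) (spectral_mass_finite f).

Lemma spectral_mass_setT f : spectral_mass E f setT = (sqnorm f)%:E.
Proof. by rewrite spectral_massE// proj_setT. Qed.

End SpectralMassTheory.

(** * Squared L^2 norms with respect to these measures *)

Section SquaredL2.
Variables (R : realType) (X : hilbertType R) (E : spectral_measure X).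
Variables (D : set (borelC R)) (mD : measurable D).
Implicit Types (f g : X) (F G H : borelC R -> R[i]).

Lemma sqL2_ge0 f F : (0 <= sqL2 E D f F)%E.
Proof. by apply: integral_ge0 => z _; rewrite lee_fin sqr_ge0. Qed.

Lemma eq_sqL2 f F G : (forall z, D z -> F z = G z) ->
  sqL2 E D f F = sqL2 E D f G.
Proof. by move=> FG; apply: eq_integral => z /set_mem Dz; rewrite FG. Qed.

(** Together with [|x + y|^2 <= 2 |x|^2 + 2 |y|^2], this takes the place of Minkowski's
    inequality. *)
Lemma sqL2_le_comb f F G H (a b : R) : cmeasurable F -> cmeasurable G ->
  cmeasurable H -> 0 <= a -> 0 <= b ->
  (forall z, D z -> Normc.normc (H z) ^+ 2 <=
    a * Normc.normc (F z) ^+ 2 + b * Normc.normc (G z) ^+ 2) ->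
  (sqL2 E D f H <= a%:E * sqL2 E D f F + b%:E * sqL2 E D f G)%E.
Proof.
move=> mF mG mH a0 b0 le_H; rewrite /sqL2.
have mF2 := measurable_normc_sqr (D := D) mF.
have mG2 := measurable_normc_sqr (D := D) mG.
have n0 (h : borelC R -> R[i]) z : D z -> (0 <= (Normc.normc (h z) ^+ 2)%:E)%E.
  by rewrite lee_fin sqr_ge0.
have na0 (k : R) (h : borelC R -> R[i]) z : 0 <= k -> D z ->
    (0 <= k%:E * (Normc.normc (h z) ^+ 2)%:E)%E.
  by move=> k0 _; rewrite -EFinM lee_fin mulr_ge0// sqr_ge0.
rewrite -(ge0_integralZl_EFin _ mD (n0 F) mF2 a0).
rewrite -(ge0_integralZl_EFin _ mD (n0 G) mG2 b0).
rewrite -(ge0_integralD _ mD (fun z => na0 a F z a0) (measurable_funeM _ mF2)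
  (fun z => na0 b G z b0) (measurable_funeM _ mG2)).
apply: ge0_le_integral => //.
- exact: n0.
- exact: measurable_normc_sqr.
- by apply: emeasurable_funD; exact: measurable_funeM.
Qed.

Lemma sqL2_le f F H (a : R) : cmeasurable F -> cmeasurable H -> 0 <= a ->
  (forall z, D z -> Normc.normc (H z) ^+ 2 <= a * Normc.normc (F z) ^+ 2) ->
  (sqL2 E D f H <= a%:E * sqL2 E D f F)%E.
Proof.
move=> mF mH a0 le_H.
have := @sqL2_le_comb f F F H a 0 mF mF mH a0 (lexx _).
by rewrite mul0e adde0; apply => z Dz; rewrite mul0r addr0 le_H.
Qed.

Lemma normc_sqrD (x y : R[i]) :
  Normc.normc (x + y) ^+ 2 <= 2 * Normc.normc x ^+ 2 + 2 * Normc.normc y ^+ 2.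
Proof.
rewrite !normc_sqr Re_add Im_add.
have := sqr_ge0 (complex.Re x - complex.Re y).
have := sqr_ge0 (complex.Im x - complex.Im y).
nra.
Qed.

Lemma normc_sqrM (x y : R[i]) :
  Normc.normc (x * y) ^+ 2 = Normc.normc x ^+ 2 * Normc.normc y ^+ 2.
Proof. by rewrite Normc.normcM exprMn. Qed.

Lemma sqL2_cst f c :
  sqL2 E D f (fun=> c) = (Normc.normc c ^+ 2 * sqnorm (E D f))%:E.
Proof.
rewrite EFinM -(spectral_massE E f mD).
exact: (@integral_cst _ _ _ (spectral_mass E f) D).
Qed.

Lemma sqnorm_proj_le B f : measurable B -> sqnorm (E B f) <= sqnorm f.
Proof.
move=> mB; rewrite -lee_fin -spectral_massE// -(spectral_mass_setT E).
by apply: le_measure; rewrite //; apply/mem_set.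
Qed.

(** Comparison with the constant 1, whose squared norm is the mass of [D], at most [|f|^2]. *)
Lemma sqL2_bounded f F (M : R) : cmeasurable F ->
  (forall z, D z -> Normc.normc (F z) ^+ 2 <= M) ->
  (sqL2 E D f F <= (`|M| * sqnorm f)%:E)%E.
Proof.
move=> mF FM; have m1 := cmeasurable_cst (1 : R[i]).
apply: (le_trans (sqL2_le f m1 mF (normr_ge0 M) _)).
  move=> z Dz; rewrite Normc.normc1 expr1n mulr1.
  by apply: le_trans (FM _ Dz) _; exact: ler_norm.
rewrite sqL2_cst Normc.normc1 expr1n mul1r -EFinM lee_fin ler_wpM2l//.
exact: sqnorm_proj_le.
Qed.

Lemma sqL2_dominated_cvg f (H_ : nat -> borelC R -> R[i]) H G (c : R) :
  (forall n, cmeasurable (H_ n)) -> cmeasurable H -> cmeasurable G ->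
  (sqL2 E D f G < +oo)%E -> 0 <= c ->
  (forall n z, D z ->
    Normc.normc (H_ n z) ^+ 2 <= c * Normc.normc (G z) ^+ 2) ->
  (forall z, D z ->
    Normc.normc (H_ n z) ^+ 2 @[n --> \oo] --> Normc.normc (H z) ^+ 2) ->
  sqL2 E D f (H_ n) @[n --> \oo] --> sqL2 E D f H.
Proof.
move=> mH_ mH mG fG c0 domH cvgH.
have [] // := @dominated_convergence _ _ _ (spectral_mass E f) D mD
  (fun n z => (Normc.normc (H_ n z) ^+ 2)%:E)
  (fun z => (Normc.normc (H z) ^+ 2)%:E)
  (fun z => c%:E * (Normc.normc (G z) ^+ 2)%:E)%E.
- by move=> n; exact: measurable_normc_sqr.
- exact: measurable_normc_sqr.
- by apply/aeW => z Dz; apply: cvg_EFin; [exact: nearW | exact: cvgH].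
- apply: integrableZl => //; apply/integrableP; split.
    exact: measurable_normc_sqr.
  apply: le_lt_trans fG; apply: ge0_le_integral => //.
  + by apply: measurableT_comp => //; exact: measurable_normc_sqr.
  + exact: measurable_normc_sqr.
  + by move=> z Dz; rewrite gee0_abs// lee_fin sqr_ge0.
- apply/aeW => z n Dz.
  by rewrite -EFinM/= lee_fin ger0_norm ?sqr_ge0// domH.
Qed.

End SquaredL2.

(** * The spectral integral as an isometry *)

Section SpectralIntegralTheory.
Variables (R : realType) (X : hilbertType R) (E : spectral_measure X).
Variables (D : set (borelC R)) (mD : measurable D).
Implicit Types (f g : X) (F G H : borelC R -> R[i]) (s r : simple_fct R).

Local Notation Phi := (sf_spectral_integral E D).
Local Notation L2 := (sqL2 E D).

Lemma Re_sum (I : Type) (l : seq I) (x : I -> R[i]) :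
  complex.Re (\sum_(i <- l) x i) = \sum_(i <- l) complex.Re (x i).
Proof. by apply: (big_morph (@complex.Re R)) => // ? ?; exact: Re_add. Qed.

Lemma normc_sqrE (x : R[i]) :
  Normc.normc x ^+ 2 = complex.Re (x * Num.conj x).
Proof.
by rewrite normc_sqr; case: x => a b /=; rewrite mulrN opprK -!expr2.
Qed.

Lemma normc_sqr_sum (I : Type) (l : seq I) (x : I -> R[i]) :
  Normc.normc (\sum_(i <- l) x i) ^+ 2 =
  \sum_(i <- l) \sum_(j <- l) complex.Re (x i * Num.conj (x j)).
Proof.
rewrite normc_sqrE rmorph_sum mulr_suml Re_sum; apply: eq_bigr => i _.
by rewrite mulr_sumr Re_sum.
Qed.

Lemma sqnorm_sum (I : Type) (l : seq I) (x : I -> X) :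
  sqnorm (\sum_(i <- l) x i) = \sum_(i <- l) \sum_(j <- l) rdot (x i) (x j).
Proof.
rewrite /sqnorm rdot_suml; apply: eq_bigr => i _.
by rewrite rdotC rdot_suml; apply: eq_bigr => j _; rewrite rdotC.
Qed.

Lemma innerZr (a : R[i]) f g : inner f (a *: g) = Num.conj a * inner f g.
Proof. by rewrite innerC linearZl_LR/= rmorphM/= -innerC. Qed.

Lemma innerZl (a : R[i]) f g : inner (a *: f) g = a * inner f g.
Proof. exact: linearZl_LR. Qed.

Lemma rdot_proj (a b : R[i]) B B' f : measurable B -> measurable B' ->
  rdot (a *: E B f) (b *: E B' f) =
  complex.Re (a * Num.conj b) * sqnorm (E (B `&` B') f).
Proof.
move=> mB mB'; rewrite /rdot innerZl innerZr inner_proj// mulrA.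
move: (a * _) => c.
by rewrite Re_mul/= mulr0 subr0.
Qed.

(** Both sides expand into double sums over pairs of indices. The terms agree because
    [(E(B) f, E(B') f)] is the mass of the intersection of [B] and [B']. *)
Lemma sf_isometry s f : L2 f (sf_eval s) = (sqnorm (Phi s f))%:E.
Proof.
have mI (k l : 'I_(sf_size s)) : measurable (sf_set k `&` sf_set l).
  by apply: measurableI; exact: sf_measurable.
have mS (k : 'I_(sf_size s)) : measurable (sf_set k `&` D).
  by apply: measurableI => //; exact: sf_measurable.
pose c (p : 'I_(sf_size s) * 'I_(sf_size s)) : R :=
  complex.Re (sf_coef p.1 * Num.conj (sf_coef p.2)).
transitivity (\int[spectral_mass E f]_(z in D)
  \sum_p ((c p)%:E * (\1_(sf_set p.1 `&` sf_set p.2) z)%:E))%E.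
  apply: eq_integral => z _.
  rewrite /sf_eval normc_sqr_sum pair_bigA/= -sumEFin.
  apply: eq_bigr => p _; rewrite -EFinM; congr (_%:E).
  rewrite /c indicI/= !indicE.
  by case: (_ \in _); case: (_ \in _);
    rewrite ?rmorphM/= ?rmorph1 ?rmorph0 ?mulr1 ?mulr0 ?mul0r ?rmorph0 ?mulr0.
rewrite integral_sum//; last first.
  move=> p; apply: integrableZl => //.
  by apply: (integrableS measurableT) => //; exact: integrable_indic.
rewrite /sf_spectral_integral sqnorm_sum pair_bigA/= -sumEFin.
apply: eq_bigr => p _.
rewrite integralZl//; last first.
  by apply: (integrableS measurableT) => //; exact: integrable_indic.
rewrite integral_indic// rdot_proj// EFinM; congr (_ * _)%E.
rewrite -setIIl -spectral_massE//; last exact: measurableI.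
Qed.

Lemma Phi_comb c s r f : Phi (sf_comb c s r) f = c *: Phi s f + Phi r f.
Proof.
rewrite /sf_spectral_integral.
rewrite (sf_comb_sum c s r (fun x B => x *: E (B `&` D) f)) scaler_sumr.
by congr (_ + _); apply: eq_bigr => k _; rewrite scalerA.
Qed.

Lemma Phi_linear s a f g : Phi s (a *: f + g) = a *: Phi s f + Phi s g.
Proof.
rewrite /sf_spectral_integral scaler_sumr -big_split/=.
apply: eq_bigr => k _; rewrite proj_linear ?scalerDr ?scalerA 1?mulrC//.
by apply: measurableI => //; exact: sf_measurable.
Qed.

Lemma L2_sf_sub s r f :
  L2 f (fun z => sf_eval s z - sf_eval r z) = (sqnorm (Phi s f - Phi r f))%:E.
Proof.
rewrite -[Phi s f - _]addrC -scaleN1r -Phi_comb -sf_isometry.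
by apply: eq_sqL2 => z _; rewrite sf_comb_eval mulN1r addrC.
Qed.

Lemma normc_sqrN (x : R[i]) : Normc.normc (- x) ^+ 2 = Normc.normc x ^+ 2.
Proof. by rewrite !normc_sqr Re_opp Im_opp !sqrrN. Qed.

(** By isometry the left-hand side is the squared norm of [s - r], which is split through [F].
    Cauchy sequences of integrals and uniqueness of their limit both come from this bound. *)
Lemma sqnorm_Phi_sub F s r f : cmeasurable F ->
  ((sqnorm (Phi s f - Phi r f))%:E <=
   2%:E * L2 f (F \- sf_eval s)%R + 2%:E * L2 f (F \- sf_eval r)%R)%E.
Proof.
move=> mF; rewrite -L2_sf_sub.
apply: sqL2_le_comb => //.
- by apply: cmeasurableB => //; exact: cmeasurable_sf.
- by apply: cmeasurableB => //; exact: cmeasurable_sf.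
- by apply: cmeasurableB => //; exact: cmeasurable_sf.
move=> z _; rewrite -(normc_sqrN (F z - sf_eval s z)).
rewrite (_ : _ - _ = - (F z - sf_eval s z) + (F z - sf_eval r z)).
  exact: normc_sqrD.
by rewrite opprB addrA subrK.
Qed.

Lemma cvge0_comb (a b : R) (u v : (\bar R)^nat) :
  u n @[n --> \oo] --> 0%E -> v n @[n --> \oo] --> 0%E ->
  (a%:E * u n + b%:E * v n)%E @[n --> \oo] --> 0%E.
Proof.
move=> u0 v0; have a0 : (a%:E * u n)%E @[n --> \oo] --> (a%:E * 0)%E.
  exact: cvgeZl.
have b0 : (b%:E * v n)%E @[n --> \oo] --> (b%:E * 0)%E by exact: cvgeZl.
rewrite mule0 in a0; rewrite mule0 in b0.
by rewrite -[X in _ --> X]adde0; apply: cvgeD.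
Qed.

(** This makes the value chosen by [get] in [spectral_integral] independent of the approximating
    sequence. *)
Lemma spectral_integral_at_uniq F f y y' : cmeasurable F ->
  spectral_integral_at E D F f y -> spectral_integral_at E D F f y' -> y = y'.
Proof.
move=> mF [s [sF sy]] [r [rF ry]].
apply: sqnorm_eq0_eq.
have c1 : (sqnorm (Phi (s n) f - Phi (r n) f))%:E @[n --> \oo] --> 0%E.
  have c0 := cvge0_comb 2 2 sF rF.
  apply: (squeeze_cvge _ (cvg_cst 0%E) c0).
  by apply: nearW => n; rewrite lee_fin sqnorm_ge0 sqnorm_Phi_sub.
have /fine_cvgP[_ c1'] := c1.
have c2 : sqnorm (Phi (s n) f - Phi (r n) f) @[n --> \oo] --> sqnorm (y - y').
  by apply: sqnorm_cvg_val; exact: cvgB.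
exact: (cvg_unique (@Rhausdorff R) c2 c1').
Qed.

(* The approximating sequence depends on [F] only, not on [f]: this is what
   makes the integral linear in [f]. *)
Lemma spectral_integral_approx F : cmeasurable F ->
  exists s : (simple_fct R)^nat, forall f, (L2 f F < +oo)%E ->
    [/\ L2 f (F \- sf_eval (s n))%R @[n --> \oo] --> 0%E,
        L2 f (sf_eval (s n)) @[n --> \oo] --> L2 f F
      & cvg (Phi (s n) f @[n --> \oo])].
Proof.
move=> mF; have [s [sF cRe cIm]] := complex_simple_approx mF.
exists s => f fF; have ms n := cmeasurable_sf (s n).
have c1 : L2 f (F \- sf_eval (s n))%R @[n --> \oo] --> 0%E.
  have -> : 0%E = L2 f (fun=> 0).
    by rewrite sqL2_cst// Normc.normc0 expr0n/= mul0r.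
  (* The constant 4 comes from [|F - s|^2 <= 2 |F|^2 + 2 |s|^2] and [|s| <= |F|]. *)
  apply: (@sqL2_dominated_cvg _ _ _ _ mD f (fun n => F \- sf_eval (s n)) _ F 4).
  - by move=> n; exact: cmeasurableB.
  - exact: cmeasurable_cst.
  - exact: mF.
  - exact: fF.
  - by [].
  - move=> n z _; apply: le_trans (normc_sqrD _ _) _; rewrite normc_sqrN.
    by have := sF n z; lra.
  - move=> z _; rewrite Normc.normc0 expr2 mul0r.
    have c0 : (complex.Re (F z) - complex.Re (sf_eval (s n) z)) ^+ 2 +
        (complex.Im (F z) - complex.Im (sf_eval (s n) z)) ^+ 2 @[n --> \oo] -->
        (complex.Re (F z) - complex.Re (F z)) ^+ 2 +
        (complex.Im (F z) - complex.Im (F z)) ^+ 2.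
      by apply: cvgD; rewrite ?expr2;
        (apply: cvgM; apply: cvgB => //; exact: cvg_cst).
    rewrite !subrr expr2 mul0r addr0 in c0.
    apply: cvg_trans c0; apply: near_eq_cvg; apply: nearW => n.
    by rewrite normc_sqr Re_add Im_add Re_opp Im_opp.
split => //.
  apply: (@sqL2_dominated_cvg _ _ _ _ mD f (fun n => sf_eval (s n)) _ F 1) =>
    //.
    by move=> n z _; rewrite mul1r.
  move=> z _; under eq_fun do rewrite normc_sqr.
  by rewrite normc_sqr; apply: cvgD; apply: cvgM.
apply: sqnorm_cauchy_cvg => e e0.
(* Each of the two errors enters [sqnorm_Phi_sub] with a factor 2. *)
have e4 : 0 < e / 4 by rewrite divr_gt0.
have /fine_cvgP[[N1 _ fin1] /cvgrPdist_lt/(_ _ e4)[N2 _ small2]] := c1.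
exists (maxn N1 N2) => m n; rewrite !geq_max => /andP[m1 m2] /andP[n1 n2].
rewrite -lte_fin; apply: le_lt_trans (sqnorm_Phi_sub _ _ _ mF) _.
have := small2 _ m2; have := small2 _ n2; rewrite /= !sub0r !normrN.
rewrite -(fineK (fin1 _ m1)) -(fineK (fin1 _ n1)) -!EFinM -EFinD lte_fin /=.
set x := fine _; set y := fine _.
by have := ler_norm x; have := ler_norm y; lra.
Qed.

Definition sint F f : X := spectral_integral E D F f.

Lemma sint_at_eq F f y : cmeasurable F ->
  spectral_integral_at E D F f y -> sint F f = y.
Proof.
move=> mF Fy; apply: (@spectral_integral_at_uniq F f) => //.
exact: (@getPex _ [set y | spectral_integral_at E D F f y] (ex_intro _ y Fy)).
Qed.

Lemma sint_approx F : cmeasurable F ->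
  exists s : (simple_fct R)^nat, forall f, (L2 f F < +oo)%E ->
    L2 f (F \- sf_eval (s n))%R @[n --> \oo] --> 0%E /\
    Phi (s n) f @[n --> \oo] --> sint F f.
Proof.
move=> mF; have [s sP] := spectral_integral_approx mF.
exists s => f /sP[sF _ /cvg_ex[y sy]]; split => //.
suff -> : sint F f = y by [].
by apply: sint_at_eq => //; exists s.
Qed.

Lemma sint_isometry F f : cmeasurable F -> (L2 f F < +oo)%E ->
  (sqnorm (sint F f))%:E = L2 f F.
Proof.
move=> mF fF; have [s /(_ f fF)[sF s2 /cvg_ex[y sy]]] :=
  spectral_integral_approx mF.
have -> : sint F f = y by apply: sint_at_eq => //; exists s.
apply: (cvg_unique (@ereal_hausdorff R) _ s2) => /=.
under eq_fun do rewrite sf_isometry.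
by apply: cvg_EFin; [exact: nearW | exact: sqnorm_cvg_val].
Qed.

Lemma sint_comb c F G f : cmeasurable F -> cmeasurable G ->
  (L2 f F < +oo)%E -> (L2 f G < +oo)%E ->
  sint (fun z => c * F z + G z) f = c *: sint F f + sint G f.
Proof.
move=> mF mG fF fG.
have mcFG : cmeasurable (fun z => c * F z + G z).
  by apply: cmeasurableD => //; exact: cmeasurableZ.
have [s /(_ f fF)[sF sy]] := sint_approx mF.
have [r /(_ f fG)[rG ry]] := sint_approx mG.
apply: sint_at_eq => //.
exists (fun n => sf_comb c (s n) (r n)); split; last first.
  under eq_fun do rewrite Phi_comb.
  by apply: cvgD => //; apply: cvgZl_tmp.
(* The coefficients of [|c x + y|^2 <= 2 |c|^2 |x|^2 + 2 |y|^2], applied to the two approximation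
   errors. *)
have c0 := cvge0_comb (2 * Normc.normc c ^+ 2) 2 sF rG.
apply: (squeeze_cvge _ (cvg_cst 0%E) c0).
apply: nearW => n; rewrite sqL2_ge0/=; apply: sqL2_le_comb => //.
- by apply: cmeasurableB => //; exact: cmeasurable_sf.
- by apply: cmeasurableB => //; exact: cmeasurable_sf.
- by apply: cmeasurableB => //; exact: cmeasurable_sf.
- by rewrite mulr_ge0// sqr_ge0.
move=> z _ /=; rewrite -mulrA -normc_sqrM sf_comb_eval.
rewrite (_ : _ - _ = c * (F z - sf_eval (s n) z) + (G z - sf_eval (r n) z)).
  exact: normc_sqrD.
by rewrite mulrBr opprD addrACA.
Qed.

Lemma sint_sub F G f : cmeasurable F -> cmeasurable G ->
  (L2 f F < +oo)%E -> (L2 f G < +oo)%E ->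
  sint F f - sint G f = sint (fun z => F z - G z) f.
Proof.
move=> mF mG fF fG.
have -> : (fun z => F z - G z) = (fun z => -1 * G z + F z).
  by apply/funext => z; rewrite mulN1r addrC.
by rewrite sint_comb// scaleN1r addrC.
Qed.

(** One sequence of simple functions serves the three vectors at once, and the integrals of its
    terms are linear in the vector. *)
Lemma sint_linear F a f g : cmeasurable F ->
  (L2 f F < +oo)%E -> (L2 g F < +oo)%E -> (L2 (a *: f + g)%R F < +oo)%E ->
  sint F (a *: f + g) = a *: sint F f + sint F g.
Proof.
move=> mF fF gF fgF; have [s sP] := sint_approx mF.
have [_ cfg] := sP _ fgF; have [_ cf] := sP _ fF; have [_ cg] := sP _ gF.
apply: (cvg_unique (@norm_hausdorff _ X) cfg) => /=.
under eq_fun do rewrite Phi_linear.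
by apply: cvgD => //; apply: cvgZl_tmp.
Qed.

Lemma sint_sf s f : sint (sf_eval s) f = Phi s f.
Proof.
apply: sint_at_eq; first exact: cmeasurable_sf.
exists (fun=> s); split; last exact: cvg_cst.
rewrite (_ : (fun=> _) = cst 0%E); first exact: cvg_cst.
apply/funext => n; rewrite (@eq_sqL2 _ _ _ _ f _ (fun=> 0)).
  by rewrite sqL2_cst// Normc.normc0 expr0n/= mul0r.
by move=> z _ /=; rewrite subrr.
Qed.

(** Multiplicativity when one factor is an indicator: restricting the approximations of [F] to [B]
    has the same effect on their integrals as projecting [f]. *)
Lemma sint_proj F B f : cmeasurable F -> measurable B ->
  (L2 f F < +oo)%E -> (L2 (E (B `&` D) f) F < +oo)%E ->
  sint F (E (B `&` D) f) = sint (fun z => F z * \1_B z) f.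
Proof.
move=> mF mB fF BfF; have [s sP] := sint_approx mF.
have [sF _] := sP _ fF; have [_ sBf] := sP _ BfF.
have mB1 := cmeasurable_indic mB.
symmetry; apply: sint_at_eq; first exact: cmeasurableM.
exists (fun n => sf_restr (s n) mB); split.
  apply: (squeeze_cvge _ (cvg_cst 0%E) sF).
  apply: nearW => n; rewrite sqL2_ge0/= -[leRHS]mul1e.
  apply: sqL2_le => //.
  - by apply: cmeasurableB => //; exact: cmeasurable_sf.
  - apply: cmeasurableB => //; [exact: cmeasurableM | exact: cmeasurable_sf].
  move=> z _ /=; rewrite mul1r sf_restr_eval -mulrBl normc_sqrM indicE.
  by case: (_ \in _); rewrite ?Normc.normc1 ?Normc.normc0 ?expr1n ?expr0n/=
    ?mulr1 ?mulr0// sqr_ge0.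
apply: cvg_trans sBf; apply: near_eq_cvg; apply: nearW => n.
apply: eq_bigr => k _ /=; rewrite -proj_setI.
- by rewrite setIACA setIid.
- by apply: measurableI => //; exact: sf_measurable.
- exact: measurableI.
Qed.

End SpectralIntegralTheory.

(** * Bounded functions *)

Section SpectralSupport.
Variables (R : realType) (X : hilbertType R) (E : spectral_measure X).

(** Open rectangles with rational sides form a countable base of the plane. *)
Definition cbox (q : rat * rat * rat * rat) : set R[i] :=
  [set z | [/\ ratr q.1.1.1 < complex.Re z, complex.Re z < ratr q.1.1.2,
               ratr q.1.2 < complex.Im z & complex.Im z < ratr q.2]].

Lemma open_cbox q : open (cbox q : set (R[i])^o).
Proof.
have -> : cbox q = (@complex.Re R @^-1` `]ratr q.1.1.1, ratr q.1.1.2[) `&`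
    (@complex.Im R @^-1` `]ratr q.1.2, ratr q.2[).
  apply/seteqP; split => z /=; rewrite !in_itv/=.
    by case=> -> -> -> ->.
  by case=> /andP[? ?] /andP[? ?]; split.
apply: openI; apply: open_comp; try exact: interval_open.
  by move=> z _; exact: continuous_Re.
by move=> z _; exact: continuous_Im.
Qed.

Lemma cbox_nbhs (U : set (R[i])^o) z : open U -> U z ->
  exists2 q, cbox q z & cbox q `<=` U.
Proof.
move=> oU Uz.
have /nbhs_ballP[_ /complex_gt0P[e e0 ->] eU] : nbhs z U.
  exact: open_nbhs_nbhs.
(* Sides within [e / 2] of each coordinate of [z] keep squared distances below [e^2 / 2]. *)
have e2 : 0 < e / 2 by rewrite divr_gt0.
have lo (x : R) : x - e / 2 < x by rewrite ltrBlDr ltrDl.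
have hi (x : R) : x < x + e / 2 by rewrite ltrDl.
have [q1 /[!in_itv]/= /andP[l1 u1]] := rat_in_itvoo (lo (complex.Re z)).
have [q2 /[!in_itv]/= /andP[l2 u2]] := rat_in_itvoo (hi (complex.Re z)).
have [q3 /[!in_itv]/= /andP[l3 u3]] := rat_in_itvoo (lo (complex.Im z)).
have [q4 /[!in_itv]/= /andP[l4 u4]] := rat_in_itvoo (hi (complex.Im z)).
exists (q1, q2, q3, q4); first by split.
move=> w [/= w1 w2 w3 w4]; apply: eU; rewrite -ball_normE/=.
rewrite normc_def ltcR -[X in _ < X](ger0_norm (ltW e0)) -sqrtr_sqr.
rewrite ltr_sqrt ?exprn_gt0// Re_add Im_add Re_opp Im_opp.
nra.
Qed.

Lemma sqnorm_proj_setC (B : set (borelC R)) f : measurable B ->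
  sqnorm (f - E B f) = sqnorm (E (~` B) f).
Proof.
move=> mB; have mC : measurable (~` B) by exact: measurableC.
have [_ iB sB] := proj_orthogonal E mB.
have : (sqnorm f)%:E = (sqnorm (E B f) + sqnorm (E (~` B) f))%:E.
  rewrite EFinD -!spectral_massE// -(spectral_mass_setT E) -(setUv B).
  by rewrite measureU// setICr.
move=> [fE]; rewrite sqnormB fE.
have -> : rdot f (E B f) = sqnorm (E B f) by rewrite /sqnorm /rdot sB iB.
lra.
Qed.

(** An enumeration of the rectangles that [E] annihilates; any other index yields the empty set,
    which [E] annihilates too. *)
Definition null_cbox (n : nat) : set (borelC R) :=
  if @unpickle (rat * rat * rat * rat)%type n is Some q then
    if `[< forall f, E (cbox q) f = 0 >] then cbox q else set0
  else set0.

(** A Lindelof argument: a point off the support has an open neighbourhood [U] with [E U = 0], and a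
    rational rectangle inside [U] around it is annihilated as well. Measurability of the support and
    nullity of its complement follow by countability. *)
Lemma setC_spectral_support :
  ~` (spectral_support E : set (borelC R)) = \bigcup_n null_cbox n.
Proof.
apply/seteqP; split => z.
  move=> /existsNP[U /not_implyP[oU /not_implyP[Uz /forallNP UE]]].
  have [q qz qU] := cbox_nbhs oU Uz.
  apply: (ex_intro2 _ _ (pickle q) I); rewrite /null_cbox pickleK.
  case: asboolP => [_ //|[]] f.
  have mq : measurable (cbox q : set (borelC R)).
    by apply: open_measurable_borelC; exact: open_cbox.
  rewrite -(setIidl qU) proj_setI//; last exact: open_measurable_borelC.
  have -> : E U f = 0 by apply: contrapT => /eqP; exact: UE.
  (* Linearity at these arguments yields [E (cbox q) 0 = 0]. *)
  by have := proj_linear E mq (-1) 0 0; rewrite scaler0 addr0 scaleN1r addNr.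
move=> [n _]; rewrite /null_cbox; case: unpickle => // q.
case: asboolP => // qE qz /(_ _ (@open_cbox q) qz)[f].
by rewrite qE eqxx.
Qed.

Lemma measurable_null_cbox n : measurable (null_cbox n).
Proof.
rewrite /null_cbox; case: unpickle => // q; case: asboolP => // _.
by apply: open_measurable_borelC; exact: open_cbox.
Qed.

Lemma measurable_spectral_support :
  measurable (spectral_support E : set (borelC R)).
Proof.
rewrite -[X in measurable X]setCK setC_spectral_support.
by apply: measurableC; apply: bigcup_measurable => n _;
  exact: measurable_null_cbox.
Qed.

Lemma proj_spectral_support f : E (spectral_support E) f = f.
Proof.
have mS := measurable_spectral_support.
apply/esym/sqnorm_eq0_eq; rewrite sqnorm_proj_setC//.
have mC := measurableC mS.
suff : spectral_mass E f (~` (spectral_support E : set (borelC R))) = 0%E.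
  by rewrite spectral_massE// => -[].
rewrite setC_spectral_support.
have mU : measurable (\bigcup_n null_cbox n).
  by apply: bigcup_measurable => n _; exact: measurable_null_cbox.
suff neg : (spectral_mass E f).-negligible (\bigcup_n null_cbox n).
  exact: (proj1 (@negligibleP _ _ _ (spectral_mass E f) _ mU) neg).
apply: negligible_bigcup => n; apply/negligibleP.
  exact: measurable_null_cbox.
transitivity (sqnorm (E (null_cbox n) f))%:E.
  exact: spectral_massE (measurable_null_cbox n).
suff -> : E (null_cbox n) f = 0 by rewrite sqnorm0.
rewrite /null_cbox; case: unpickle => [q|]; last exact: proj_set0.
by case: asboolP => // _; exact: proj_set0.
Qed.

End SpectralSupport.

(** * Multiplicativity of the integral of bounded functions *)

Section BoundedFunctions.
Variables (R : realType) (X : hilbertType R) (E : spectral_measure X).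
Variables (D : set (borelC R)) (mD : measurable D).
Implicit Types (f g : X) (F G H : borelC R -> R[i]) (s r : simple_fct R).

Local Notation Phi := (sf_spectral_integral E D).
Local Notation L2 := (sqL2 E D).
Local Notation sint := (sint E D).

(** Boundedness is asked on [D] alone: the exponentials are bounded on a spectrum lying in a left
    half-plane, but in general not on the plane. *)
Definition bounded_borel F : Prop := cmeasurable F /\
  exists M : R, forall z, D z -> Normc.normc (F z) ^+ 2 <= M.

Lemma bounded_borel_L2 F f : bounded_borel F -> (L2 f F < +oo)%E.
Proof.
by move=> [mF [M FM]]; apply: le_lt_trans (sqL2_bounded _ mD _ mF FM) (ltry _).
Qed.

Lemma bounded_borelM F G : bounded_borel F -> bounded_borel G ->
  bounded_borel (fun z => F z * G z).
Proof.
move=> [mF [M FM]] [mG [N GN]]; split; first exact: cmeasurableM.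
by exists (M * N) => z Dz; rewrite normc_sqrM ler_pM ?sqr_ge0 ?FM ?GN.
Qed.

Lemma bounded_borelD F G : bounded_borel F -> bounded_borel G ->
  bounded_borel (fun z => F z + G z).
Proof.
move=> [mF [M FM]] [mG [N GN]]; split; first exact: cmeasurableD.
exists (2 * M + 2 * N) => z Dz; apply: le_trans (normc_sqrD _ _) _.
by rewrite lerD// ler_pM2l// ?FM ?GN.
Qed.

Lemma bounded_borel_cst c : bounded_borel (fun=> c).
Proof. by split; [exact: cmeasurable_cst | exists (Normc.normc c ^+ 2)]. Qed.

Lemma bounded_borel_indic B : measurable B ->
  bounded_borel (\1_B : borelC R -> R[i]).
Proof.
move=> mB; split; [exact: cmeasurable_indic | exists 1 => z _].
by rewrite indicE; case: (_ \in _);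
  rewrite ?Normc.normc1 ?Normc.normc0 ?expr1n// expr2 mul0r.
Qed.

Lemma bounded_borel_sum (I : Type) (l : seq I) (F : I -> borelC R -> R[i]) :
  (forall i, bounded_borel (F i)) ->
  bounded_borel (fun z => \sum_(i <- l) F i z).
Proof.
move=> bF; elim: l => [|i l IHl].
  rewrite (_ : (fun=> _) = fun=> 0); first exact: bounded_borel_cst.
  by apply/funext => z; rewrite big_nil.
rewrite (_ : (fun=> _) = fun z => F i z + \sum_(j <- l) F j z).
  exact: bounded_borelD.
by apply/funext => z; rewrite big_cons.
Qed.

Lemma sint_bounded F f (M : R) : cmeasurable F ->
  (forall z, D z -> Normc.normc (F z) ^+ 2 <= M) ->
  sqnorm (sint F f) <= `|M| * sqnorm f.
Proof.
move=> mF FM; rewrite -lee_fin sint_isometry//; first exact: sqL2_bounded.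
by apply: (@bounded_borel_L2 F f); split => //; exists M.
Qed.

Lemma bounded_sint_linear F a f g : bounded_borel F ->
  sint F (a *: f + g) = a *: sint F f + sint F g.
Proof.
by move=> bF; apply: sint_linear => //; [by case: bF | | | ];
  exact: (bounded_borel_L2 _ bF).
Qed.

Lemma bounded_sint0 F : bounded_borel F -> sint F 0 = 0.
Proof.
move=> [mF [M FM]]; apply: sqnorm_eq0; apply/eqP.
rewrite eq_le sqnorm_ge0 andbT.
by have := sint_bounded 0 mF FM; rewrite sqnorm0 mulr0.
Qed.

Lemma bounded_sintB F f g : bounded_borel F ->
  sint F (f - g) = sint F f - sint F g.
Proof.
move=> bF; rewrite addrC -scaleN1r bounded_sint_linear// scaleN1r.
by rewrite addrC.
Qed.

Lemma bounded_sint_sub F G f : bounded_borel F -> bounded_borel G ->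
  sqnorm (sint F f - sint G f) = fine (L2 f (fun z => F z - G z)).
Proof.
move=> bF bG; have [mF _] := bF; have [mG _] := bG.
have mFG := cmeasurableB mF mG.
have bFG : bounded_borel (fun z => F z - G z).
  rewrite (_ : (fun=> _) = fun z => F z + -1 * G z).
    apply: bounded_borelD => //; apply: bounded_borelM => //.
    exact: bounded_borel_cst.
  by apply/funext => z; rewrite mulN1r.
rewrite sint_sub ?bounded_borel_L2//.
by rewrite -sint_isometry// bounded_borel_L2.
Qed.

(** Multiplicativity when one factor is simple, by induction on its terms, each being a multiple of
    an indicator. *)
Lemma bounded_sint_Phi F s f : bounded_borel F ->
  sint F (Phi s f) = sint (fun z => F z * sf_eval s z) f.
Proof.
move=> bF; have [mF _] := bF; rewrite /sf_spectral_integral /sf_eval.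
have bI k : bounded_borel (fun z => sf_coef (s := s) k * \1_(sf_set k) z).
  apply: bounded_borelM; first exact: bounded_borel_cst.
  by apply: bounded_borel_indic; exact: sf_measurable.
elim: (index_enum _) => [|k l IHl].
  rewrite big_nil bounded_sint0//.
  rewrite (_ : (fun=> _) = sf_eval (@SimpleFct R 0 (fun=> 0) (fun=> set0)
    (fun=> measurable0))).
    by rewrite sint_sf// /sf_spectral_integral big_ord0.
  by apply/funext => z; rewrite big_nil mulr0 /sf_eval big_ord0.
have bl := bounded_borel_sum l bI.
have mk : measurable (sf_set (s := s) k) by exact: sf_measurable.
have bFk : bounded_borel (fun z => F z * \1_(sf_set k) z).
  by apply: bounded_borelM => //; exact: bounded_borel_indic.
have bFl := bounded_borelM bF bl.
rewrite big_cons (bounded_sint_linear _ _ _ bF) IHl.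
rewrite (sint_proj mD mF mk (bounded_borel_L2 f bF) (bounded_borel_L2 _ bF)).
rewrite -(sint_comb mD _ bFk.1 bFl.1 (bounded_borel_L2 f bFk)
  (bounded_borel_L2 f bFl)).
have -> // : (fun z => F z * \sum_(i <- k :: l) sf_coef i * \1_(sf_set i) z) =
  (fun z => sf_coef k * (F z * \1_(sf_set k) z) +
            F z * \sum_(i <- l) sf_coef i * \1_(sf_set i) z).
by apply/funext => z; rewrite big_cons mulrDr mulrCA.
Qed.

(** With simple functions [s n] tending to [G], both sides are limits of [sint F (Phi (s n) f)]: the
    left one because [sint F] is a bounded operator, the right one because [F * s n] tends to
    [F * G] in L^2. *)
Lemma bounded_sintM F G f : bounded_borel F -> bounded_borel G ->
  sint F (sint G f) = sint (fun z => F z * G z) f.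
Proof.
move=> bF bG; have [mF [M FM]] := bF; have [mG _] := bG.
have [s /(_ f (bounded_borel_L2 f bG))[sG sy]] := sint_approx E mD mG.
have bs n : bounded_borel (sf_eval (s n)).
  apply: bounded_borel_sum => k; apply: bounded_borelM.
    exact: bounded_borel_cst.
  by apply: bounded_borel_indic; exact: sf_measurable.
have cA : sint F (Phi (s n) f) @[n --> \oo] --> sint F (sint G f).
  apply: cvg_sqnorm.
  have c0 : `|M| * sqnorm (Phi (s n) f - sint G f) @[n --> \oo] --> (0 : R).
    rewrite -[X in _ --> X](mulr0 `|M|); apply: cvgMl_tmp.
    exact: (sqnorm_cvg sy).
  apply: (squeeze_cvgr _ (cvg_cst 0) c0).
  apply: nearW => n; rewrite sqnorm_ge0/= -bounded_sintB//.
  exact: sint_bounded.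
have cB : sint F (Phi (s n) f) @[n --> \oo] --> sint (fun z => F z * G z) f.
  apply: cvg_sqnorm.
  have /fine_cvgP[[N _ fin] c0] := sG.
  have c1 : `|M| * fine (L2 f (G \- sf_eval (s n))%R) @[n --> \oo] --> (0 : R).
    by rewrite -[X in _ --> X](mulr0 `|M|); apply: cvgMl_tmp.
  apply: (squeeze_cvgr _ (cvg_cst 0) c1).
  exists N => // n /fin fn /=; rewrite sqnorm_ge0/= bounded_sint_Phi//.
  rewrite sqnormBC bounded_sint_sub//; [|exact: bounded_borelM..].
  have mGs : cmeasurable (G \- sf_eval (s n))%R.
    by apply: cmeasurableB => //; case: (bs n).
  rewrite -lee_fin EFinM (fineK fn).
  rewrite fineK; last first.
    rewrite ge0_fin_numE ?sqL2_ge0//.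
    rewrite (@eq_sqL2 _ _ _ _ _ _ (fun z => F z * (G z - sf_eval (s n) z))).
      refine (bounded_borel_L2 _ _); apply: bounded_borelM => //; split => //.
      have [_ [N1 N1P]] := bG; have [_ [N2 N2P]] := bs n.
      exists (2 * N1 + 2 * N2) => z Dz; apply: le_trans (normc_sqrD _ _) _.
      by rewrite normc_sqrN lerD// ler_pM2l ?N1P ?N2P.
    by move=> z _; rewrite mulrBr.
  apply: sqL2_le => //.
    by apply: cmeasurableB; apply: cmeasurableM => //; case: (bs n).
  move=> z Dz /=; rewrite -mulrBr normc_sqrM ler_wpM2r ?sqr_ge0//.
  by apply: le_trans (FM _ Dz) _; exact: ler_norm.
exact: (cvg_unique (@norm_hausdorff _ X) cA cB).
Qed.

End BoundedFunctions.

(** * Exponentials *)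

Section ComplexExponential.
Variable R : realType.
Implicit Types (t : R) (z : R[i]).

Lemma abs_sin_le (x : R) : `|sin x| <= `|x|.
Proof.
wlog x0 : x / 0 <= x.
  move=> H; have [/H//|/ltW x0] := leP 0 x.
  by rewrite -(normrN (sin x)) -(normrN x) -sinN; apply: H; rewrite oppr_ge0.
have [c _] := MVT_segment x0 (fun x _ => is_derive_sin x)
  (continuous_subspaceT (@continuous_sin R)).
rewrite sin0 !subr0 => ->; rewrite normrM ler_piMl//.
exact: cos_max.
Qed.

(** The half-angle formula: the left-hand side is [4 sin^2 (y / 2)]. *)
Lemma one_minus_cos_le (y : R) : 2 * (1 - cos y) <= y ^+ 2.
Proof.
have := abs_sin_le (y / 2); rewrite -(ler_pXn2r (n := 2)) ?nnegrE//.
rewrite !real_normK ?num_real// => le_sin.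
have cosE : cos y = 1 - 2 * sin (y / 2) ^+ 2.
  rewrite {1}(splitr y) cosD -!expr2 cos2sin2; lra.
have : (y / 2) ^+ 2 = y ^+ 2 / 4 by field.
rewrite cosE; lra.
Qed.

(** For [x >= 0], [1 - x <= e^(-x)] gives [e^x - 1 <= x e^x]; for [x <= 0], [1 + x <= e^x] gives
    [1 - e^x <= - x]. *)
Lemma expR_sub1_sqr_le (x w : R) : x <= w -> 0 <= w ->
  (expR x - 1) ^+ 2 <= x ^+ 2 * expR w ^+ 2.
Proof.
move=> xw w0; have ew : 1 <= expR w by rewrite -expR0 ler_expR.
have h1 := expR_ge1Dx x.
have [x0|/ltW x0] := leP 0 x.
  have h2 := expR_ge1Dx (- x); rewrite expRN in h2.
  have ex0 := expR_gt0 x.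
  have h3 : expR x - 1 <= x * expR x.
    have : (1 - x) * expR x <= 1 by rewrite -ler_pdivlMr// div1r.
    lra.
  have h4 : expR x <= expR w by rewrite ler_expR.
  rewrite -exprMn ler_pXn2r ?nnegrE//; first last.
  - by rewrite mulr_ge0// ltW// expR_gt0.
  - lra.
  by apply: le_trans h3 _; rewrite ler_wpM2l.
have h2 : expR x <= 1 by rewrite expR_le1.
apply: (@le_trans _ _ (x ^+ 2)).
  rewrite -(sqrrN (_ - 1)) -(sqrrN x) ler_pXn2r ?nnegrE//; lra.
by rewrite ler_peMr ?sqr_ge0// expr_ge1// expR_ge0.
Qed.

Definition texp t z : R[i] := cexp (t%:C%C * z).

Lemma Re_texp t z : complex.Re (texp t z) =
  expR (t * complex.Re z) * cos (t * complex.Im z).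
Proof. by case: z => a b; rewrite /texp /cexp/= !mul0r subr0 addr0 subr0. Qed.

Lemma Im_texp t z : complex.Im (texp t z) =
  expR (t * complex.Re z) * sin (t * complex.Im z).
Proof. by case: z => a b; rewrite /texp /cexp/= !mul0r subr0 !addr0. Qed.

Lemma normc_texp_sqr t z :
  Normc.normc (texp t z) ^+ 2 = expR (t * complex.Re z) ^+ 2.
Proof.
rewrite normc_sqr Re_texp Im_texp !exprMn -mulrDr.
by rewrite cos2Dsin2 mulr1.
Qed.

Lemma texp0 z : texp 0 z = 1.
Proof.
apply/eqP; rewrite eq_complex Re_texp Im_texp !mul0r expR0 cos0 sin0.
by rewrite mulr1 mulr0 !eqxx.
Qed.

Lemma texpD s t z : texp (s + t) z = texp s z * texp t z.
Proof.
apply/eqP; rewrite eq_complex (Re_mul (texp s z)) (Im_mul (texp s z)).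
rewrite !Re_texp !Im_texp.
rewrite !mulrDl expRD cosD sinD.
by apply/andP; split; apply/eqP; ring.
Qed.

Lemma cmeasurable_texp t : cmeasurable (texp t : borelC R -> R[i]).
Proof.
have mRe : measurable_fun setT (fun z : borelC R => expR (t * complex.Re z)).
  apply: measurableT_comp; first exact: measurable_expR.
  by apply: measurable_funM; [exact: measurable_cst | exact: measurable_Re].
have mIm : measurable_fun setT (fun z : borelC R => t * complex.Im z).
  by apply: measurable_funM; [exact: measurable_cst | exact: measurable_Im].
split.
  under eq_fun do rewrite Re_texp; apply: measurable_funM => //.
  apply: measurableT_comp mIm; apply: continuous_measurable_fun.
  exact: continuous_cos.
under eq_fun do rewrite Im_texp; apply: measurable_funM => //.
apply: measurableT_comp mIm; apply: continuous_measurable_fun.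
exact: continuous_sin.
Qed.

(** With [x + i y = t z], the left-hand side is [(e^x - 1)^2 + 2 e^x (1 - cos y)], and
    [e^x <= e^w <= e^(2w)]. Divided by [t^2], the bound no longer depends on [t]. *)
Lemma normc_texp_sub1_le t z (w : R) : 0 <= w -> t * complex.Re z <= w ->
  Normc.normc (texp t z - 1) ^+ 2 <=
  t ^+ 2 * (expR w ^+ 2 * Normc.normc z ^+ 2).
Proof.
move=> w0 zw; rewrite !normc_sqr Re_add Im_add Re_opp Im_opp Re_texp Im_texp/=.
set x := t * complex.Re z in zw *; set y := t * complex.Im z.
have ex0 := expR_gt0 x.
have -> : (expR x * cos y - 1) ^+ 2 + (expR x * sin y + - 0) ^+ 2 =
    (expR x - 1) ^+ 2 + expR x * (2 * (1 - cos y)).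
  rewrite oppr0 addr0 (exprMn _ _ (sin y)) sin2cos2; ring.
have -> : t ^+ 2 * (expR w ^+ 2 * (complex.Re z ^+ 2 + complex.Im z ^+ 2)) =
    x ^+ 2 * expR w ^+ 2 + expR w ^+ 2 * y ^+ 2 by rewrite /x /y; ring.
apply: lerD; first exact: expR_sub1_sqr_le.
apply: ler_pM => //.
- apply: (@le_trans _ _ (expR w)); first by rewrite ler_expR.
  by rewrite expr2 ler_peMl ?expR_ge0// -expR0 ler_expR.
- exact: one_minus_cos_le.
Qed.

Lemma is_derive_diffquot (g : R -> R) (l : R) (u : R^nat) :
  is_derive (0 : R) 1 g l -> (forall n, 0 < u n) -> u @ \oo --> (0 : R) ->
  (u n)^-1 * (g (u n) - g 0) @[n --> \oo] --> l.
Proof.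
move=> [dg dgl] u0 cu; move: dg => /cvg_ex[l' dg].
have el : l = l' by rewrite -dgl; apply/cvg_lim.
rewrite -el in dg.
have := cvg_dnbhs_at_right dg => /cvg_at_rightP/(_ u (conj u0 cu)).
apply: cvg_trans; apply: near_eq_cvg; apply: nearW => n /=.
by rewrite scaler1 addr0.
Qed.

Lemma is_derive_mulr (a x : R) : is_derive x 1 (fun t : R => t * a) a.
Proof.
have := is_deriveZ a (is_derive_id x 1).
have -> : a \*: (@id R) = (fun t => t * a).
  by apply/funext => t /=; rewrite /GRing.scale/= mulrC.
by rewrite /GRing.scale/= mulr1.
Qed.

(** Covers the real and the imaginary part of [e^(tz)] at once, with [trig] the cosine or the
    sine. *)
Lemma is_derive_expR_mul_trig (trig : R -> R) (a b c d : R) :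
  is_derive (0 : R) 1 trig d -> trig 0 = c ->
  is_derive (0 : R) 1 (fun t => expR (t * a) * trig (t * b)) (a * c + b * d).
Proof.
move=> dtrig trig0.
have da : is_derive (0 : R) 1 (expR \o (fun t => t * a)) (1 * a).
  apply: is_derive1_comp; last exact: is_derive_mulr.
  by have := is_derive_expR (0 : R); rewrite expR0 mul0r.
have db : is_derive (0 : R) 1 (trig \o (fun t => t * b)) (d * b).
  by apply: is_derive1_comp; [rewrite mul0r | exact: is_derive_mulr].
have := is_deriveM da db; rewrite /= !mul0r expR0 trig0.
by congr is_derive; rewrite /GRing.scale/= mul1r; ring.
Qed.

Lemma cvg_texp_diffquot z (u : R^nat) : (forall n, 0 < u n) ->
  u @ \oo --> (0 : R) ->
  (u n)^-1 * complex.Re (texp (u n) z - 1) @[n --> \oo] --> complex.Re z /\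
  (u n)^-1 * complex.Im (texp (u n) z - 1) @[n --> \oo] --> complex.Im z.
Proof.
move=> u0 cu; split.
  have d0 : is_derive (0 : R) 1 cos 0.
    by have := is_derive_cos (0 : R); rewrite sin0 oppr0.
  have := is_derive_expR_mul_trig (complex.Re z) (complex.Im z) d0 (cos0 R).
  rewrite mulr1 mulr0 addr0 => /is_derive_diffquot/(_ u0 cu).
  apply: cvg_trans; apply: near_eq_cvg; apply: nearW => n.
  by rewrite Re_add Re_opp Re_texp !mul0r expR0 cos0 mulr1.
have d0 : is_derive (0 : R) 1 sin 1.
  by have := is_derive_sin (0 : R); rewrite cos0.
have := is_derive_expR_mul_trig (complex.Re z) (complex.Im z) d0 (sin0 R).
rewrite mulr1 mulr0 add0r => /is_derive_diffquot/(_ u0 cu).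
apply: cvg_trans; apply: near_eq_cvg; apply: nearW => n.
by rewrite Im_add Im_opp Im_texp !mul0r expR0 sin0 mulr0 oppr0.
Qed.

End ComplexExponential.

Section RightLimits.
Variable R : realType.

(** A positive null sequence eventually agrees with its truncation at 1. Restricting to [t <= 1] is
    what makes the majorants of [e^(tz)] below uniform in [t]. *)
Lemma cvg_at_right0 (h : R -> R) :
  (forall u : R^nat, (forall n, 0 < u n) -> (forall n, u n <= 1) ->
    u @ \oo --> (0 : R) -> h (u n) @[n --> \oo] --> (0 : R)) ->
  h t @[t --> (0 : R)^'+] --> (0 : R).
Proof.
move=> H; apply/cvg_at_rightP => u [u0 cu].
pose v n := Num.min (u n) 1.
have v0 n : 0 < v n by rewrite lt_min u0 ltr01.
have v1 n : v n <= 1 by rewrite ge_min lexx orbT.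
have cv : v @ \oo --> (0 : R).
  apply: (squeeze_cvgr _ (cvg_cst 0) cu).
  by apply: nearW => n; rewrite (ltW (v0 n)) ge_min lexx.
apply: cvg_trans (H v v0 v1 cv); apply: near_eq_cvg.
have u1 : \forall n \near \oo, u n < 1 by exact: cvgr_lt cu _ ltr01.
by apply: filterS u1 => n un1; rewrite /v min_l// ltW.
Qed.

End RightLimits.

(** * The exponentials of [A] *)

Section OperatorExponentials.
Variables (R : realType) (X : hilbertType R).
Variables (A : operator X) (E : spectral_measure X).
Hypothesis EA : is_spectral_measure_of A E.

Let D : set (borelC R) := spectrum A.
Local Notation L2 := (sqL2 E D).
Local Notation sint := (sint E D).

Lemma measurable_spectrum : measurable D.
Proof. by rewrite /D; case: EA => <- _; exact: measurable_spectral_support. Qed.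
Let mD := measurable_spectrum.

Lemma proj_spectrum f : E D f = f.
Proof. by rewrite /D; case: EA => <- _; exact: proj_spectral_support. Qed.

Lemma exp_op_isometry t f : (L2 f (texp t) < +oo)%E ->
  (sqnorm (exp_op A E t f))%:E = L2 f (texp t).
Proof. by move=> fin; apply: sint_isometry => //; exact: cmeasurable_texp. Qed.

Lemma exp_not_hypercyclic : (exists x : X, x != 0) ->
  ~ hypercyclic_collection [set t : R | 0 <= t] (exp_op A E).
Proof.
move=> X0 [f [fdom df]].
have fin t : 0 <= t -> (L2 f (texp t) < +oo)%E by move=> /fdom.
pose P : set (borelC R) := [set z | 0 < complex.Re z].
have mP : measurable P.
  have := @measurable_Re R measurableT _ (measurable_itv `]0, +oo[).
  rewrite setTI; congr measurable; apply/seteqP; split => z /=.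
    by rewrite in_itv/= andbT.
  by rewrite in_itv/= andbT.
have mPD : measurable (P `&` D) by exact: measurableI.
(* If the right half-plane is null for [f], then [|e^(tz)| <= 1] almost everywhere and the orbit
   stays in the ball of radius [|f|]. *)
have [c0|cp] := eqVneq (sqnorm (E (P `&` D) f)) 0.
  have [_ [t t0 <-]] := dense_sqnorm_unbounded (sqnorm f) X0 df.
  rewrite ltNge => /negP; apply.
  rewrite -lee_fin exp_op_isometry ?fin//.
  have -> : (sqnorm f)%:E = L2 f (fun=> 1).
    by rewrite sqL2_cst// Normc.normc1 expr1n mul1r proj_spectrum.
  apply: (@ae_ge0_le_integral _ _ _ (spectral_mass E f) D) => //.
  - by move=> z _; rewrite lee_fin sqr_ge0.
  - by apply: measurable_normc_sqr; exact: cmeasurable_texp.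
  - by move=> z _; rewrite lee_fin sqr_ge0.
  exists (P `&` D); split => //.
    exact: etrans (spectral_massE E f mPD) (congr1 EFin c0).
  move=> z /not_implyP[Dz /negP]; rewrite lee_fin -ltNge => lt_z.
  split => //; rewrite /P/= ltNge; apply/negP => z0.
  move: lt_z; rewrite Normc.normc1 expr1n normc_texp_sqr ltNge => /negP; apply.
  by rewrite expr_le1// ?expR_ge0// expR_le1 mulr_ge0_le0.
have cpos : 0 < sqnorm (E (P `&` D) f) by rewrite lt_def cp sqnorm_ge0.
have [_ [t t0 <-]] := dense_sqnorm_small cpos df.
rewrite ltNge => /negP; apply.
rewrite -lee_fin exp_op_isometry ?fin//.
(* Otherwise the positive mass of [P] bounds the orbit from below: it is the squared norm of the
   indicator of [P], which [|e^(tz)|] dominates for [t >= 0]. *)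
have -> : (sqnorm (E (P `&` D) f))%:E = L2 f (sf_eval (sf_indic mP)).
  rewrite sf_isometry// /sf_spectral_integral big_ord_recl big_ord0.
  by rewrite addr0 scale1r.
rewrite -[leRHS]mul1e; apply: sqL2_le => //.
- exact: cmeasurable_texp.
- exact: cmeasurable_sf.
move=> z _; rewrite mul1r sf_indic_eval normc_texp_sqr indicE.
have [Pz|_] := boolP (z \in P); last first.
  by rewrite Normc.normc0 expr2 mul0r sqr_ge0.
rewrite Normc.normc1 expr1n expr_ge1// ?expR_ge0//.
rewrite -expR0 ler_expR mulr_ge0//.
by move: Pz; rewrite inE => /ltW.
Qed.

(** * Semigroup and generator for a spectrum in a left half-plane *)

Section LeftHalfPlane.
Variable w : R.
Hypothesis spec_w : spectrum A `<=` [set z | complex.Re z <= w].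

(** The bound is [|w|] because [t * w] may exceed a negative [w]. *)
Lemma mul_Re_spectrum_le t z : 0 <= t -> t <= 1 -> D z ->
  t * complex.Re z <= `|w|.
Proof.
move=> t0 t1 /spec_w /= zw; apply: (@le_trans _ _ (t * `|w|)).
  by rewrite ler_wpM2l//; apply: le_trans zw _; exact: ler_norm.
by rewrite ler_piMl.
Qed.

Lemma bounded_texp t : 0 <= t -> bounded_borel D (texp t).
Proof.
move=> t0; split; first exact: cmeasurable_texp.
exists (expR (t * w) ^+ 2) => z /spec_w /= zw.
rewrite normc_texp_sqr ler_pXn2r ?nnegrE ?expR_ge0//.
by rewrite ler_expR ler_wpM2l.
Qed.

Lemma texp_sub_cst_bounded t c : 0 <= t ->
  bounded_borel D (fun z => texp t z + c).
Proof.
move=> t0; apply: bounded_borelD; first exact: bounded_texp.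
exact: bounded_borel_cst.
Qed.

(** Rests on [E D f = f], the spectrum being the support of [E]. *)
Lemma sint_cst c f : sint (fun=> c) f = c *: f.
Proof.
pose s := @SimpleFct R 1 (fun=> c) (fun=> setT) (fun=> measurableT).
have -> : (fun=> c) = sf_eval s.
  apply/funext => z; rewrite /sf_eval big_ord_recl big_ord0 addr0.
  by rewrite indicT mulr1.
rewrite sint_sf// /sf_spectral_integral big_ord_recl big_ord0 addr0/=.
by rewrite setTI proj_spectrum.
Qed.

Lemma sint1 f : sint (fun=> 1) f = f.
Proof. by rewrite sint_cst scale1r. Qed.

Lemma exp_op_sub_id t f : 0 <= t ->
  sqnorm (exp_op A E t f - f) = fine (L2 f (fun z => texp t z - 1)).
Proof.
move=> t0; rewrite -{2}(sint1 f).
apply: bounded_sint_sub => //; first exact: bounded_texp.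
exact: bounded_borel_cst.
Qed.

Lemma exp_op_continuous_at0 f : exp_op A E t f @[t --> 0^'+] --> f.
Proof.
apply: cvg_sqnorm; apply: cvg_at_right0 => u u0 u1 cu.
have c0 : L2 f (fun z => texp (u n) z - 1) @[n --> \oo] --> 0%E.
  have -> : 0%E = L2 f (fun=> 0).
    by rewrite sqL2_cst// Normc.normc0 expr2 !mul0r.
  (* A constant majorant, integrable as the measure is finite: [|e^(tz) - 1|^2 <= 2 |e^(tz)|^2 + 2],
     with [|e^(tz)| <= e^|w|] on the spectrum. *)
  apply: (@sqL2_dominated_cvg _ _ _ _ mD f _ _ (fun=> 1)
    (2 * expR `|w| ^+ 2 + 2)).
  - move=> n; apply: cmeasurableB; first exact: cmeasurable_texp.
    exact: cmeasurable_cst.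
  - exact: cmeasurable_cst.
  - exact: cmeasurable_cst.
  - by rewrite sqL2_cst// ltry.
  - by rewrite addr_ge0// mulr_ge0// sqr_ge0.
  - move=> n z Dz; rewrite Normc.normc1 expr1n mulr1.
    apply: le_trans (normc_sqrD _ _) _.
    rewrite normc_sqrN Normc.normc1 expr1n mulr1 lerD2r ler_pM2l//.
    rewrite normc_texp_sqr ler_pXn2r ?nnegrE ?expR_ge0// ler_expR.
    by rewrite mul_Re_spectrum_le// ltW.
  move=> z Dz; rewrite Normc.normc0 expr2 mul0r.
  have c1 : u n ^+ 2 * (expR `|w| ^+ 2 * Normc.normc z ^+ 2) @[n --> \oo]
      --> (0 * 0) * (expR `|w| ^+ 2 * Normc.normc z ^+ 2).
    by apply: cvgMr_tmp; apply: cvgM; exact: cu.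
  rewrite !mul0r in c1; apply: (squeeze_cvgr _ (cvg_cst 0) c1).
  apply: nearW => n; rewrite sqr_ge0/= normc_texp_sub1_le//.
  by rewrite mul_Re_spectrum_le// ltW.
have /fine_cvgP[_] := c0; apply: cvg_trans; apply: near_eq_cvg.
by apply: nearW => n /=; rewrite exp_op_sub_id// ltW.
Qed.

Lemma exp_op_C0_semigroup : C0_semigroup (exp_op A E).
Proof.
split.
- move=> t t0; have bt := bounded_texp t0; split.
  + by apply/seteqP; split => // f _; exact: (bounded_borel_L2 E mD f bt).
  + by move=> a f g; exact: (bounded_sint_linear E mD a f g bt).
  + move=> f; apply: cvg_sqnorm; have [mt [M tM]] := bt.
    have c0 : `|M| * sqnorm (g - f) @[g --> f] --> (0 : R).
      rewrite -[X in _ --> X](mulr0 `|M|); apply: cvgMl_tmp.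
      by apply: sqnorm_cvg; exact: cvg_id.
    apply: (squeeze_cvgr _ (cvg_cst 0) c0).
    apply: nearW => g; rewrite sqnorm_ge0/=.
    rewrite -[exp_op A E t g - _](bounded_sintB E mD g f bt).
    exact: (sint_bounded E mD _ mt tM).
- move=> f; have texp0E : texp (0 : R) = (fun=> 1).
    by apply/funext => z; exact: texp0.
  by rewrite -[RHS]sint1 -texp0E.
- move=> s t f s0 t0.
  have texpDE : texp (s + t) = fun z => texp s z * texp t z.
    by apply/funext => z; exact: texpD.
  rewrite [RHS](bounded_sintM E mD f (bounded_texp s0) (bounded_texp t0)).
  by rewrite -texpDE.
- exact: exp_op_continuous_at0.
Qed.

Definition diffquot t (z : borelC R) : R[i] :=
  (t^-1)%:C%C * (texp t z - 1).

Lemma Re_diffquot t z :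
  complex.Re (diffquot t z) = t^-1 * complex.Re (texp t z - 1).
Proof.
by rewrite /diffquot; move: (_ - _) => c; rewrite Re_mul/= mul0r subr0.
Qed.

Lemma Im_diffquot t z :
  complex.Im (diffquot t z) = t^-1 * complex.Im (texp t z - 1).
Proof.
by rewrite /diffquot; move: (_ - _) => c; rewrite Im_mul/= mul0r addr0.
Qed.

Lemma bounded_diffquot t : 0 <= t -> bounded_borel D (diffquot t).
Proof.
move=> t0; apply: bounded_borelM; first exact: bounded_borel_cst.
exact: texp_sub_cst_bounded.
Qed.

Lemma sint_diffquot t f : 0 <= t ->
  (t^-1)%:C%C *: (exp_op A E t f - f) = sint (diffquot t) f.
Proof.
move=> t0; set c := (t^-1)%:C%C.
have -> : diffquot t = (fun z => c * texp t z + - c).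
  by apply/funext => z; rewrite /diffquot mulrBr mulr1.
rewrite sint_comb//.
- by rewrite sint_cst scaleNr scalerBr.
- exact: cmeasurable_texp.
- exact: bounded_borel_L2 (bounded_texp t0).
- exact: bounded_borel_L2 (bounded_borel_cst _ _).
Qed.

(** A majorant uniform in [t], integrable exactly when [f] lies in the domain of [A]. *)
Lemma normc_diffquot_le t z : 0 < t -> t <= 1 -> D z ->
  Normc.normc (diffquot t z) ^+ 2 <= expR `|w| ^+ 2 * Normc.normc z ^+ 2.
Proof.
move=> t0 t1 Dz; rewrite normc_sqrM normc_sqr/= (expr2 0) mulr0 addr0.
rewrite exprVn ler_pdivrMl ?exprn_gt0//.
by apply: normc_texp_sub1_le => //; rewrite mul_Re_spectrum_le// ltW.
Qed.

Lemma cvg_diffquot z (u : R^nat) : (forall n, 0 < u n) ->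
  u @ \oo --> (0 : R) ->
  complex.Re (diffquot (u n) z) @[n --> \oo] --> complex.Re z /\
  complex.Im (diffquot (u n) z) @[n --> \oo] --> complex.Im z.
Proof.
move=> u0 cu; have [cRe cIm] := cvg_texp_diffquot z u0 cu.
split; [apply: cvg_trans cRe | apply: cvg_trans cIm];
  apply: near_eq_cvg; apply: nearW => n.
  by rewrite Re_diffquot.
by rewrite Im_diffquot.
Qed.

Lemma generator_exp_cvg f : (L2 f id < +oo)%E ->
  (t^-1)%:C%C *: (exp_op A E t f - f) @[t --> 0^'+] --> sint id f.
Proof.
move=> fin; apply: cvg_sqnorm; apply: cvg_at_right0 => u u0 u1 cu.
have mid := @cmeasurable_id R.
have bdq n := bounded_diffquot (ltW (u0 n)).
have mdq n : cmeasurable (fun z => diffquot (u n) z - z).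
  by apply: cmeasurableB => //; case: (bdq n).
have c0 : L2 f (fun z => diffquot (u n) z - z) @[n --> \oo] --> 0%E.
  have -> : 0%E = L2 f (fun=> 0).
    by rewrite sqL2_cst// Normc.normc0 expr2 !mul0r.
  (* The coefficient bounds [2 |diffquot|^2 + 2 |z|^2] by a multiple of [|z|^2]. *)
  apply: (@sqL2_dominated_cvg _ _ _ _ mD f _ _ id
    (2 * expR `|w| ^+ 2 + 2)) => //.
  - move=> n z Dz; apply: le_trans (normc_sqrD _ _) _.
    rewrite normc_sqrN (mulrDl (2 * expR `|w| ^+ 2)) lerD2r -mulrA ler_pM2l//.
    exact: normc_diffquot_le.
  move=> z Dz; rewrite Normc.normc0 expr2 mul0r.
  have [cRe cIm] := cvg_diffquot z u0 cu.
  have c1 : (complex.Re (diffquot (u n) z) - complex.Re z) ^+ 2 +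
      (complex.Im (diffquot (u n) z) - complex.Im z) ^+ 2 @[n --> \oo] -->
      (complex.Re z - complex.Re z) ^+ 2 + (complex.Im z - complex.Im z) ^+ 2.
    by apply: cvgD; rewrite ?expr2;
      (apply: cvgM; apply: cvgB => //; exact: cvg_cst).
  rewrite !subrr expr2 mul0r addr0 in c1.
  apply: cvg_trans c1; apply: near_eq_cvg; apply: nearW => n.
  by rewrite normc_sqr Re_add Im_add Re_opp Im_opp.
have /fine_cvgP[finc0] := c0; apply: cvg_trans; apply: near_eq_cvg.
apply: filterS finc0 => n fn /=; rewrite sint_diffquot; last exact: ltW.
rewrite sint_sub//; first last.
- exact: bounded_borel_L2 (bdq n).
- by case: (bdq n).
by rewrite -sint_isometry// -ge0_fin_numE// sqL2_ge0.
Qed.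

(** Along [t = 1 / (n + 1)] the squared L^2 norms of the quotients tend to [|l|^2] by isometry,
    while the quotients tend pointwise to [z]; Fatou's lemma bounds the integral of [|z|^2] by
    [|l|^2]. *)
Lemma generator_exp_dom f : dom (generator (exp_op A E)) f -> (L2 f id < +oo)%E.
Proof.
move=> /cvg_ex[l cl].
pose u (n : nat) : R := n.+1%:R^-1.
have u0 n : 0 < u n by rewrite invr_gt0.
have cu : u @ \oo --> (0 : R) by exact: cvg_harmonic.
have bdq n := bounded_diffquot (ltW (u0 n)).
have cL2 : L2 f (diffquot (u n)) @[n --> \oo] --> (sqnorm l)%:E.
  have cr : sqnorm ((t^-1)%:C%C *: (exp_op A E t f - f)) @[t --> (0 : R)^'+]
      --> sqnorm l by exact: sqnorm_cvg_val cl.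
  have /cvg_at_rightP/(_ u (conj u0 cu)) cn := cr.
  have cE : (sqnorm ((u n)^-1%:C%C *: (exp_op A E (u n) f - f)))%:E
      @[n --> \oo] --> (sqnorm l)%:E.
    by apply: cvg_EFin; [exact: nearW | exact: cn].
  apply: cvg_trans cE; apply: near_eq_cvg; apply: nearW => n /=.
  rewrite sint_diffquot; last exact: ltW.
  by rewrite sint_isometry//; [case: (bdq n) | exact: bounded_borel_L2 (bdq n)].
apply: (@le_lt_trans _ _ (sqnorm l)%:E); last exact: ltry.
have [<- _] := cvg_limn_einf_sup cL2.
have := @fatou _ _ _ (spectral_mass E f) D mD
  (fun n z => (Normc.normc (diffquot (u n) z) ^+ 2)%:E).
have -> : (\int[spectral_mass E f]_(z in D)
    limn_einf (fun n => (Normc.normc (diffquot (u n) z) ^+ 2)%:E) = L2 f id)%E.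
  apply: eq_integral => z _.
  have [cRe cIm] := cvg_diffquot z u0 cu.
  apply: (cvg_limn_einf_sup _).1; apply: cvg_EFin; first exact: nearW.
  have c1 : complex.Re (diffquot (u n) z) ^+ 2 +
      complex.Im (diffquot (u n) z) ^+ 2 @[n --> \oo] -->
      complex.Re z ^+ 2 + complex.Im z ^+ 2.
    by apply: cvgD; rewrite ?expr2; apply: cvgM.
  rewrite normc_sqr.
  apply: cvg_trans c1; apply: near_eq_cvg; apply: nearW => n.
  exact: esym (normc_sqr (diffquot (u n) z)).
apply => [n|n z _]; last by rewrite lee_fin sqr_ge0.
by apply: measurable_normc_sqr; case: (bdq n).
Qed.

Lemma generator_exp : op_eq A (generator (exp_op A E)).
Proof.
have [domA valA] := EA.2.
have domE : dom A = dom (generator (exp_op A E)).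
  rewrite domA; apply/seteqP; split => f.
    by move=> /generator_exp_cvg cf; apply/cvg_ex; exists (sint id f).
  exact: generator_exp_dom.
split => // f Af; rewrite (valA f Af).
apply/esym/cvg_lim; first exact: norm_hausdorff.
by apply: generator_exp_cvg; move: Af; rewrite domA.
Qed.

End LeftHalfPlane.
End OperatorExponentials.

Theorem theorem3p1 (R : realType) (X : hilbertType R)
    (X_nonzero : exists x : X, x != 0)
    (A : operator X) (A_normal : normal_op A) :
  ~ hypercyclic A /\
  (forall E : spectral_measure X, is_spectral_measure_of A E ->
    ~ hypercyclic_collection [set t : R | 0 <= t] (exp_op A E) /\
    (forall w : R, spectrum A `<=` [set z | complex.Re z <= w] ->
      C0_semigroup (exp_op A E) /\ op_eq A (generator (exp_op A E)))).
Proof.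
split; first exact: normal_not_hypercyclic.
move=> E EA; split; first exact: exp_not_hypercyclic.
by move=> w Aw; split;
  [exact: exp_op_C0_semigroup Aw | exact: generator_exp Aw].
Qed.
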